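(* Let $\mathbb{F}_q$ be a finite field, $m>1$ an integer and $\varphi$ the Euler function. (i) The cyclic Galois group $\mathrm{Gal}(\mathbb{F}_{q^m}/\mathbb{F}_q)$ of order $m$ has $\varphi(m)$ generators, and there are $\varphi(m)$ different classes of non-isomorphic semifields $(\mathbb{F}_{q^m}/\mathbb{F}_q,\sigma_i,a)$ with $a\in\mathbb{F}_{q^m}\setminus\mathbb{F}_q$, one class for each choice of generator $\sigma_i$ of $\mathrm{Gal}(\mathbb{F}_{q^m}/\mathbb{F}_q)$ (semifields constructed from different generators are not isomorphic). (ii) If $m$ is prime and $m$ does not divide $q-1$, then there are exactly $$\frac{(m-1)(q^m-q)}{m(q-1)}$$ non-isomorphic Sandler semifields of order $q^{m^2}$ with center $\mathbb{F}_q$ and left, middle and right nucleus $\mathbb{F}_{q^m}$. (iii) If $m$ is prime and $m$ divides $q-1$, then there are exactly $$(m-1)\left((m-1)+\frac{q^m-q-(q-1)(m-1)}{m(q-1)}\right)$$ non-isomorphic Sandler semifields of order $q^{m^2}$ with center $\mathbb{F}_q$ and left, middle and right nucleus $\mathbb{F}_{q^m}$.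
   Context: A semifield is a unital (not necessarily associative) division algebra over a finite field. For $\sigma$ a generator of $\mathrm{Gal}(\mathbb{F}_{q^m}/\mathbb{F}_q)$ and $a\in\mathbb{F}_{q^m}$, $(\mathbb{F}_{q^m}/\mathbb{F}_q,\sigma,a)$ denotes the Petit algebra $R/R(t^m-a)$ with $R=\mathbb{F}_{q^m}[t;\sigma]$ the twisted polynomial ring ($tc=\sigma(c)t$): the $\mathbb{F}_q$-vector space of polynomials of degree $<m$ with product $g\circ h$ equal to the remainder $r$ in the right division $gh=q'(t^m-a)+r$, $\deg r<m$. In (ii) and (iii), Sandler semifields are the opposite algebras of those algebras $(\mathbb{F}_{q^m}/\mathbb{F}_q,\sigma,a)$, with $\sigma$ a generator of $\mathrm{Gal}(\mathbb{F}_{q^m}/\mathbb{F}_q)$ and $a\in\mathbb{F}_{q^m}\setminus\mathbb{F}_q$, that are division algebras; all generators $\sigma$ are allowed, and the count is of isomorphism classes as $\mathbb{F}_q$-algebras. With associator $[x,y,z]=(xy)z-x(yz)$, the left, middle and right nuclei of an algebra $A$ are $\{x:[x,A,A]=0\}$, $\{x:[A,x,A]=0\}$, $\{x:[A,A,x]=0\}$; the center is the set of elements lying in all three nuclei that commute with every element of $A$. *)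

(* Defs.v *)
From HB Require Import structures.
From mathcomp Require Import all_boot all_order all_algebra all_fingroup.
From mathcomp Require Import all_solvable all_field.

Set Implicit Arguments.
Unset Strict Implicit.
Unset Printing Implicit Defensive.

Import GRing.Theory.
Local Open Scope ring_scope.

(* Not necessarily associative algebras; a unit is not part of the structure. *)

Record nalg (F : fieldType) := Nalg {
  nalg_sort :> lmodType F;
  nmul : nalg_sort -> nalg_sort -> nalg_sort;
  nmul_linearr : forall x, linear (nmul x);
  nmul_linearl : forall y, linear (nmul ^~ y)
}.
Arguments nmul {F n} x y.
Arguments Nalg {F} nalg_sort nmul nmul_linearr nmul_linearl.

Section NalgTheory.
Variable F : fieldType.
Implicit Types A B : nalg F.

Definition opp_nalg A : nalg F :=
  Nalg A (fun x y => nmul y x) (@nmul_linearl F A) (@nmul_linearr F A).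

Definition nalg_iso A B : Prop :=
  exists f : A -> B,
    [/\ linear f, bijective f & forall x y, f (nmul x y) = nmul (f x) (f y)].

Definition is_unit_of A (e : A) : Prop :=
  forall x, nmul e x = x /\ nmul x e = x.

Definition unital A : Prop := exists e : A, is_unit_of e.

Definition division_nalg A : Prop :=
  (exists x : A, x != 0) /\
  forall x : A, x != 0 -> bijective (nmul x) /\ bijective (nmul ^~ x).

Definition associator A (x y z : A) : A :=
  nmul (nmul x y) z - nmul x (nmul y z).

Definition left_nucleus A (x : A) : Prop := forall y z, associator x y z = 0.
Definition middle_nucleus A (x : A) : Prop := forall y z, associator y x z = 0.
Definition right_nucleus A (x : A) : Prop := forall y z, associator y z x = 0.

Definition center A (x : A) : Prop :=
  [/\ left_nucleus x, middle_nucleus x, right_nucleus x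
    & forall y, nmul x y = nmul y x].

Definition has_order A (n : nat) : Prop := exists f : 'I_n -> A, bijective f.

(* The center is the base field, embedded as the multiples of the unit. *)
Definition center_is_base A : Prop :=
  exists2 e : A, is_unit_of e & forall x, center x <-> exists c, x = c *: e.

(* [S] is a subalgebra of [A] isomorphic to the field extension [L] of [F]. *)
Definition is_copy_of (L : fieldExtType F) A (S : A -> Prop) : Prop :=
  exists f : L -> A,
    [/\ linear f, injective f, forall u v, f (u * v) = nmul (f u) (f v)
      & forall x, S x <-> exists u, x = f u].

(* There are exactly [n] isomorphism classes of algebras satisfying [P]. *)
Definition num_iso_classes (P : nalg F -> Prop) (n : nat) : Prop :=
  exists S : 'I_n -> nalg F,
    [/\ forall i, P (S i),
        forall i j, nalg_iso (S i) (S j) -> i = j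
      & forall A, P A -> exists i, nalg_iso A (S i)].

End NalgTheory.

Definition semifield (F : finFieldType) (A : nalg F) : Prop :=
  unital A /\ division_nalg A.

(* Twisted polynomials [K[t; s]], on the carrier [{poly K}] with ['X] as [t]. *)

Section Skew.
Variables (K : fieldType) (s : {rmorphism K -> K}).
Implicit Types p q r d f : {poly K}.

(* [t c = s(c) t] gives [(a t^i) (b t^j) = a s^i(b) t^(i+j)]. *)
Definition skew_mul p q : {poly K} :=
  \poly_(k < (size p + size q).-1)
    \sum_(i < k.+1) p`_i * iter i s q`_(k - i).

Lemma iter_s0 i : iter i s 0 = 0.
Proof. by elim: i => //= i ->; rewrite rmorph0. Qed.

Lemma iter_s1 i : iter i s 1 = 1.
Proof. by elim: i => //= i ->; rewrite rmorph1. Qed.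

Lemma iter_sD i : {morph iter i s : x y / x + y}.
Proof. by elim: i => //= i IH x y; rewrite -rmorphD -IH. Qed.

Lemma iter_sM i : {morph iter i s : x y / x * y}.
Proof. by elim: i => //= i IH x y; rewrite -rmorphM -IH. Qed.

Lemma iter_s_eq0 i x : (iter i s x == 0) = (x == 0).
Proof. by elim: i => //= i IH; rewrite fmorph_eq0. Qed.

Lemma iter_s_sum i n (F : 'I_n -> K) :
  iter i s (\sum_(j < n) F j) = \sum_(j < n) iter i s (F j).
Proof. by rewrite (big_morph _ (iter_sD i) (iter_s0 i)). Qed.

Lemma coef_skew_mul p q k :
  (skew_mul p q)`_k = \sum_(i < k.+1) p`_i * iter i s q`_(k - i).
Proof.
rewrite coef_poly ltn_predRL; case: leqP => // le_pq_k1.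
rewrite big1 // => j _; have [lq_p_j|lt_j_p] := leqP (size p) j.
  by rewrite nth_default ?mul0r.
rewrite [q`__]nth_default ?iter_s0 ?mulr0 // leq_subRL -ltnS //.
by rewrite (leq_trans _ le_pq_k1) // ltn_add2r.
Qed.

Lemma coef_skew_mul_rev p q k :
  (skew_mul p q)`_k = \sum_(i < k.+1) p`_(k - i) * iter (k - i) s q`_i.
Proof.
rewrite coef_skew_mul (reindex_inj rev_ord_inj) /=.
by apply: eq_bigr => j _; rewrite (sub_ordK j).
Qed.

Lemma skew_mulDl : left_distributive skew_mul +%R.
Proof.
move=> p q r; apply/polyP => k; rewrite coefD !coef_skew_mul -big_split /=.
by apply: eq_bigr => i _; rewrite coefD mulrDl.
Qed.

Lemma skew_mulDr : right_distributive skew_mul +%R.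
Proof.
move=> p q r; apply/polyP => k; rewrite coefD !coef_skew_mul -big_split /=.
by apply: eq_bigr => i _; rewrite coefD iter_sD mulrDr.
Qed.

Lemma skew_mulZl c p q : skew_mul (c *: p) q = c *: skew_mul p q.
Proof.
apply/polyP => k; rewrite coefZ !coef_skew_mul mulr_sumr.
by apply: eq_bigr => i _; rewrite coefZ mulrA.
Qed.

Lemma skew_mulZr c p q : s c = c -> skew_mul p (c *: q) = c *: skew_mul p q.
Proof.
move=> sc; have ic i : iter i s c = c by elim: i => //= i ->.
apply/polyP => k; rewrite coefZ !coef_skew_mul mulr_sumr.
by apply: eq_bigr => i _; rewrite coefZ iter_sM ic mulrCA.
Qed.

Lemma skew_mulCl c p : skew_mul c%:P p = c *: p.
Proof.
apply/polyP => k; rewrite coef_skew_mul coefZ big_ord_recl big1 => [|i _].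
  by rewrite addr0 subn0 coefC.
by rewrite coefC mul0r.
Qed.

Lemma skew_mul1l : left_id 1 skew_mul.
Proof. by move=> p; rewrite skew_mulCl scale1r. Qed.

Lemma skew_mul1r : right_id 1 skew_mul.
Proof.
move=> p; apply/polyP => k; rewrite coef_skew_mul_rev big_ord_recl big1.
  by rewrite subn0 coef1 iter_s1 mulr1 addr0.
by move=> i _; rewrite coef1 iter_s0 mulr0.
Qed.

Lemma skew_mulXC c : skew_mul 'X c%:P = (s c)%:P * 'X.
Proof.
apply/polyP => -[|k]; rewrite coef_skew_mul coefMX.
  by rewrite big_ord1 coefX mul0r.
rewrite (bigD1 (lift ord0 ord0)) //= big1 => [|i ne_i1].
  by rewrite coefX mul1r addr0 subn1 /= !coefC; case: k => //=; rewrite rmorph0.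
rewrite coefX; case: eqP => [i1|_]; last by rewrite mul0r.
by case/eqP: ne_i1; apply: val_inj.
Qed.

Lemma skew_mulA : associative skew_mul.
Proof.
move=> p q r; apply/polyP=> i; rewrite coef_skew_mul coef_skew_mul_rev.
pose coef3 j k := p`_j * (iter j s q`_(i - j - k) *
                          iter (j + (i - j - k)) s r`_k).
transitivity (\sum_(j < i.+1) \sum_(k < i.+1 | (k <= i - j)%N) coef3 j k).
  apply: eq_bigr => /= j _; rewrite coef_skew_mul_rev iter_s_sum big_distrr /=.
  rewrite (big_ord_narrow_leq (leq_subr _ _)) /=.
  by apply: eq_bigr => k _; rewrite /coef3 iter_sM -iterD.
rewrite (exchange_big_dep predT) //=; apply: eq_bigr => k _.
transitivity (\sum_(j < i.+1 | (j <= i - k)%N) coef3 j k).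
  apply: eq_bigl => j; rewrite -ltnS -(ltnS j) -!subSn ?leq_ord //.
  by rewrite -subn_gt0 -(subn_gt0 j) -!subnDA addnC.
rewrite (big_ord_narrow_leq (leq_subr _ _)) coef_skew_mul big_distrl /=.
apply: eq_bigr => j _; rewrite /coef3 -!subnDA (addnC j k) !subnDA mulrA.
by rewrite subnKC // -ltnS.
Qed.

Lemma size_skew_mul p q :
  p != 0 -> q != 0 -> size (skew_mul p q) = (size p + size q).-1.
Proof.
move=> nz_p nz_q; apply: size_poly_eq.
have p_gt0 : (0 < size p)%N by rewrite lt0n size_poly_eq0.
have q_gt0 : (0 < size q)%N by rewrite lt0n size_poly_eq0.
have i_lt : ((size p).-1 < (size p + size q).-1.-1.+1)%N.
  by move: p_gt0 q_gt0; case: (size p) (size q) => // a [] // b _ _;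
    rewrite addnS /= ltnS leq_addr.
rewrite (bigD1 (Ordinal i_lt)) //= big1 => [|i ne_i].
  have -> : ((size p + size q).-1.-1 - (size p).-1 = (size q).-1)%N.
    by move: p_gt0 q_gt0; case: (size p) (size q) => // a [] // b _ _;
      rewrite addnS /= addKn.
  by rewrite addr0 mulf_neq0 ?iter_s_eq0 // lead_coef_eq0.
have [lt_i|] := leqP (size p) i; first by rewrite nth_default ?mul0r.
move=> lt_i; rewrite [q`__]nth_default ?iter_s0 ?mulr0 //.
have {}ne_i : (i < (size p).-1)%N.
  have: nat_of_ord i != (size p).-1.
    by apply: contraNneq ne_i => e; apply/eqP/val_inj.
  move: (nat_of_ord i) lt_i => j; rewrite -{1}(prednK p_gt0) ltnS => lt_j ne_j.
  by rewrite ltn_neqAle ne_j.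
rewrite leq_subRL; last by rewrite -ltnS.
move: (nat_of_ord i) ne_i p_gt0 => j.
case: (size p) => // n lt_j _; rewrite addSn /=.
by have: (j + size q < n + size q)%N; [rewrite ltn_add2r | case: (n + _)%N].
Qed.

(* Remainder of the right division [f = q' d + r] by a monic [d]: each step
   cancels the leading term of [f]; [size f] steps are always enough. *)
Definition skew_rdiv_step d f : {poly K} :=
  if (size f < size d)%N then f
  else f - skew_mul (lead_coef f *: 'X^(size f - size d)) d.

Definition skew_rmod d f : {poly K} := iter (size f) (skew_rdiv_step d) f.

Lemma size_skew_rdiv_step d f :
  d \is monic -> (size d <= size f)%N -> f != 0 ->
  (size (skew_rdiv_step d f) < size f)%N.
Proof.
move=> mon_d le_df nz_f; rewrite /skew_rdiv_step [(size f < _)%N]ltnNge le_df /=.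
have nz_c : lead_coef f *: 'X^(size f - size d) != 0.
  by rewrite scaler_eq0 lead_coef_eq0 negb_or nz_f -size_poly_eq0 size_polyXn.
have szc : size (lead_coef f *: 'X^(size f - size d)) = (size f - size d).+1.
  by rewrite size_scale ?lead_coef_eq0 // size_polyXn.
have f_gt0 : (0 < size f)%N by rewrite lt0n size_poly_eq0.
have szm := size_skew_mul nz_c (monic_neq0 mon_d).
rewrite szc addSn /= subnK // in szm.
rewrite -[X in (_ < X)%N](prednK f_gt0) ltnS; apply/leq_sizeP => j le_fj; rewrite coefB.
have [lt_j|lt_j] := leqP (size f) j.
  by rewrite (nth_default 0 lt_j) [X in _ - X]nth_default ?subrr ?szm.
have {le_fj lt_j}-> : j = (size f).-1.
  by apply/eqP; rewrite eqn_leq le_fj andbT -ltnS prednK.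
rewrite coef_skew_mul.
have i_lt : (size f - size d < (size f).-1.+1)%N.
  rewrite prednK // ltn_subrL f_gt0 andbT lt0n size_poly_eq0.
  exact: monic_neq0.
rewrite (bigD1 (Ordinal i_lt)) //= big1 => [|i ne_i].
  rewrite coefZ coefXn eqxx mulr1.
  have -> : ((size f).-1 - (size f - size d) = (size d).-1)%N.
    have d_gt0 : (0 < size d)%N by rewrite lt0n size_poly_eq0 monic_neq0.
    by rewrite -!subn1 subnAC subKn.
  have -> : d`_(size d).-1 = 1 by apply: (monicP mon_d).
  by rewrite iter_s1 mulr1 addr0 subrr.
rewrite coefZ coefXn; case: eqP => [e|_]; last by rewrite mulr0 mul0r.
by case/eqP: ne_i; apply: val_inj.
Qed.

Lemma skew_rmodP d f : d \is monic ->
  exists2 q, f = skew_mul q d + skew_rmod d f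
           & (size (skew_rmod d f) < size d)%N.
Proof.
move=> mon_d; rewrite /skew_rmod; move: {2 3 4}(size f) (leqnn (size f)) => n.
have mul0 : skew_mul 0 d = 0 by rewrite -[0](scale0r 0) skew_mulZl !scale0r.
have d_gt0 : (0 < size d)%N by rewrite lt0n size_poly_eq0 monic_neq0.
elim: n f => [|n IH] f le_fn.
  by exists 0; rewrite ?mul0 ?add0r //= (leq_ltn_trans le_fn).
rewrite iterSr; have [lt_fd|le_df] := ltnP (size f) (size d).
  have step : skew_rdiv_step d f = f by rewrite /skew_rdiv_step lt_fd.
  have -> : iter n (skew_rdiv_step d) (skew_rdiv_step d f) = f.
    by rewrite step; elim: n {IH le_fn} => //= n ->.
  by exists 0; rewrite ?mul0 ?add0r.
have nz_f : f != 0 by rewrite -size_poly_gt0 (leq_trans d_gt0).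
have lt_sf := size_skew_rdiv_step mon_d le_df nz_f.
have [q def_q sz_q] := IH _ (leq_trans lt_sf le_fn).
exists (q + lead_coef f *: 'X^(size f - size d)) => //.
by rewrite skew_mulDl addrAC -def_q /skew_rdiv_step [(size f < _)%N]ltnNge le_df /= subrK.
Qed.

Lemma skew_rmod_uniq d q r : d \is monic -> (size r < size d)%N ->
  skew_rmod d (skew_mul q d + r) = r.
Proof.
move=> mon_d sz_r; have [q' def_f sz_r'] := skew_rmodP (skew_mul q d + r) mon_d.
set r' := skew_rmod _ _ in def_f sz_r' *.
have def_q : skew_mul (q - q') d = r' - r.
  rewrite skew_mulDl -scaleN1r skew_mulZl scaleN1r.
  by apply: (addIr r); rewrite subrK addrAC def_f addrAC subrr add0r.
have [/eqP e|nz] := eqVneq (q - q') 0.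
  apply/eqP; rewrite -subr_eq0 -def_q (eqP e).
  by rewrite -[X in skew_mul X](scale0r 0) skew_mulZl scale0r.
have := size_skew_mul nz (monic_neq0 mon_d); rewrite def_q => sz.
have: (size (r' - r)%R < size d)%N.
  by apply: leq_ltn_trans (size_polyD _ _) _; rewrite size_polyN gtn_max sz_r'.
rewrite sz; case: (size _) (size_poly_gt0 (q - q')) => [|k _].
  by rewrite nz.
by rewrite addSn /= ltnNge leq_addl.
Qed.

Lemma skew_rmod_linear d c f g : d \is monic ->
  skew_rmod d (c *: f + g) = c *: skew_rmod d f + skew_rmod d g.
Proof.
move=> mon_d; have [q def_f sz_f] := skew_rmodP f mon_d.
have [q' def_g sz_g] := skew_rmodP g mon_d.
rewrite {1}def_f {1}def_g scalerDr addrACA -skew_mulZl -skew_mulDl.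
rewrite skew_rmod_uniq // (leq_ltn_trans (size_polyD _ _)) // gtn_max sz_g.
by rewrite andbT (leq_ltn_trans (size_scale_leq _ _)).
Qed.

End Skew.

(* The polynomials of degree less than [m] over [L], as a vector space over the
   base field [F] of [L]. *)

Definition petit_space (F : fieldType) (L : fieldExtType F) (m : nat) : Type :=
  {poly_m L}.

Section PetitSpace.
Variables (F : fieldType) (L : fieldExtType F) (m : nat).
Local Notation V := (petit_space L m).

HB.instance Definition _ := GRing.Zmodule.copy V {poly_m L}.

Definition petit_scale (c : F) (v : V) : V := c%:A *: (v : {poly_m L}).

Fact petit_scaleA c c' v :
  petit_scale c (petit_scale c' v) = petit_scale (c * c') v.
Proof. by rewrite /petit_scale scalerA -scalerAl mul1r scalerA. Qed.

Fact petit_scale1 : left_id 1 petit_scale.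
Proof. by move=> v; rewrite /petit_scale !scale1r. Qed.

Fact petit_scaleDr : right_distributive petit_scale +%R.
Proof. by move=> c v w; apply: scalerDr. Qed.

Fact petit_scaleDl v : {morph petit_scale^~ v : c c' / c + c'}.
Proof. by move=> c c'; rewrite /petit_scale !scalerDl. Qed.

HB.instance Definition _ := GRing.Zmodule_isLmodule.Build F V
  petit_scaleA petit_scale1 petit_scaleDr petit_scaleDl.

End PetitSpace.

(* Petit's algebra [(L/F, sigma, a)]. *)

Section Petit.
Variables (F : fieldType) (L : splittingFieldType F).
Variables (sigma : gal_of {:L}) (a : L).
Local Notation m := (\dim {:L}).
Local Notation V := (petit_space L m).
Local Notation poly_of v := (polyn (v : {poly_m L})).

(* [npolyp] truncates at degree [m], which has no effect on the remainder. *)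
Definition petit_mul (g h : V) : V :=
  npolyp m (skew_rmod sigma ('X^m - a%:P)
             (skew_mul sigma (poly_of g) (poly_of h))).

Let monic_mod : 'X^m - a%:P \is monic.
Proof. by rewrite monicXnsubC ?adim_gt0. Qed.

Lemma petit_mulE (g h : V) :
  poly_of (petit_mul g h) =
    skew_rmod sigma ('X^m - a%:P) (skew_mul sigma (poly_of g) (poly_of h)).
Proof.
rewrite npolypK //.
have [_ _] := skew_rmodP sigma (skew_mul sigma (poly_of g) (poly_of h))
  monic_mod.
by rewrite size_XnsubC ?adim_gt0.
Qed.

Fact petit_mul_linearl (h : V) : linear (petit_mul ^~ h).
Proof.
move=> c g g'; apply: val_inj; rewrite /= !petit_mulE.
by rewrite skew_mulDl skew_mulZl skew_rmod_linear.
Qed.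

Fact petit_mul_linearr (g : V) : linear (petit_mul g).
Proof.
move=> c h h'; apply: val_inj; rewrite /= !petit_mulE.
rewrite skew_mulDr skew_mulZr ?skew_rmod_linear //.
exact: (rmorph_alg (gal_repr sigma)).
Qed.

Definition petit : nalg F := Nalg V petit_mul petit_mul_linearr petit_mul_linearl.

End Petit.
Arguments petit {F} L sigma a.

Section Sandler.
Variables (F : finFieldType) (L : splittingFieldType F).

Definition sandler (A : nalg F) : Prop :=
  exists (sigma : gal_of {:L}) (a : L),
    [/\ generator 'Gal({:L} / 1) sigma, a \notin 1%VS,
        A = opp_nalg (petit L sigma a) & semifield A].

(* The Sandler semifields over [L/F] of order [q ^ (m ^ 2)], with center [F] and
   left, middle and right nuclei [L]. *)
Definition counted_sandler (q m : nat) (A : nalg F) : Prop :=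
  [/\ sandler A, has_order A (q ^ (m ^ 2)), center_is_base A
    & [/\ is_copy_of L (@left_nucleus F A), is_copy_of L (@middle_nucleus F A)
        & is_copy_of L (@right_nucleus F A)]].

End Sandler.

(* Main.v *)
From HB Require Import structures.
Require Import Defs.
From mathcomp Require Import all_boot all_order all_algebra all_fingroup.
From mathcomp Require Import all_solvable all_field.
From mathcomp Require Import zify ring.

(** Write K for the extension of degree m, q for the order of the base field,
    s for a generator of the Galois group and X for the twisted variable.  Since
    s^m = 1, the power X^m is central, so that modulo X^m - a the power X^n
    becomes s^n(a)^(n / m) X^(n mod m).  The algebra is therefore known on
    monomials ([mul_mono]), and the associator of x X^i, y X^j, z X^k is a
    monomial of degree i + j + k mod m; for a <> 0 and x, y, z <> 0 it vanishes
    exactly when i + j < m or s^k(a) = a ([assoc_mono], [assoc_coef_small],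
    [assoc_coef_neq0]).  Taking s^k(a) <> a, a nucleus is cut out one monomial
    at a time, and only the constants K survive.

    Division.  Suppose that the conjugates s^i(a), i < m, are distinct, and that
    g h = 0 with g, h nonzero and g of degree d.  Division by g shows that
    the products u h with u of degree less than d form a K-subspace W stable
    under left multiplication by X.  The m-th power of that multiplication acts
    on X^i as the scalar s^i(a), so W contains some X^e; multiplying by X
    cyclically permutes the lines K X^i, so W is everything.  Hence u -> u h is
    onto, thus injective by finiteness, although X^d h is also some u h with u
    of smaller degree ([petit_integral]).  A generator of the group of units of
    K has distinct conjugates; when m is prime, so has every element outside
    the base field.

    Isomorphisms.  Let a and b lie outside the base field.  An isomorphism from
    the algebra of (s, a) to that of (t, b) preserves the left nucleus, so it restricts to a Galois automorphism rho on constants, and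
    comparing X c = s(c) X with its image forces X to be sent to k X^i with
    t^i = s.  Powers of X then go to monomials of degree i j mod m; the
    vanishing of the associator of X^j, X, X for j + 1 < m is preserved only if
    i = 1.  So s = t, and comparing X^m = a with its image gives
    rho(a) = N(k) b ([iso_rigid]); conversely such rho and k define an
    isomorphism ([scaling_iso]).  As the norm maps onto the base field,
    the algebras of (s, a) and (s, b) are isomorphic if and only if b lies in
    the orbit of a under scalars of the base field and Galois automorphisms
    ([petit_isoP]).

    Counting.  Let m be prime.  By Burnside's lemma, the number of orbits times
    the order m (q - 1) of the acting group is the number of pairs (g, x)
    with g x = x and x outside the base field.  The identity fixes q^m - q
    elements, and a pair (c, rho) with rho <> 1 fixes some such x exactly when
    c^m = 1 and c <> 1; by Hilbert 90 it then fixes a punctured line, of q - 1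
    elements.  There are m - 1 such c if m divides q - 1 and none otherwise,
    and m - 1 such rho ([card_twist_orbits], [card_twist_torsion]).  Passing to
    opposite algebras does not change the classification. *)

Set Implicit Arguments.
Unset Strict Implicit.
Unset Printing Implicit Defensive.

Import GRing.Theory.
Local Open Scope ring_scope.

(** * Bilinearity of products and associators *)

Section NalgBasics.
Variables (F : fieldType) (A : nalg F).
Implicit Types u v w : A.

Lemma nmul0l v : nmul 0 v = 0.
Proof.
by have := nmul_linearl v (-1) 0 0; rewrite !scaleN1r oppr0 addr0 addNr.
Qed.

Lemma nmul0r v : nmul v 0 = 0.
Proof.
by have := nmul_linearr v (-1) 0 0; rewrite !scaleN1r oppr0 addr0 addNr.
Qed.

Lemma nmulDl u v w : nmul (u + v) w = nmul u w + nmul v w.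
Proof. by have := nmul_linearl w 1 u v; rewrite !scale1r. Qed.

Lemma nmulDr u v w : nmul u (v + w) = nmul u v + nmul u w.
Proof. by have := nmul_linearr u 1 v w; rewrite !scale1r. Qed.

Lemma nmulBl u v w : nmul (u - v) w = nmul u w - nmul v w.
Proof. by apply: (addIr (nmul v w)); rewrite -nmulDl !subrK. Qed.

Lemma nmulBr u v w : nmul u (v - w) = nmul u v - nmul u w.
Proof. by apply: (addIr (nmul u w)); rewrite -nmulDr !subrK. Qed.

Lemma nmul_suml I (r : seq I) (P : pred I) (f : I -> A) v :
  nmul (\sum_(i <- r | P i) f i) v = \sum_(i <- r | P i) nmul (f i) v.
Proof. exact: (big_morph _ (fun u w => nmulDl u w v) (nmul0l v)). Qed.

Lemma nmul_sumr I (r : seq I) (P : pred I) (f : I -> A) v :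
  nmul v (\sum_(i <- r | P i) f i) = \sum_(i <- r | P i) nmul v (f i).
Proof. exact: (big_morph _ (nmulDr v) (nmul0r v)). Qed.

Lemma associator_suml I (r : seq I) (P : pred I) (f : I -> A) v w :
  associator (\sum_(i <- r | P i) f i) v w
  = \sum_(i <- r | P i) associator (f i) v w.
Proof. by rewrite /associator !nmul_suml sumrB. Qed.

Lemma associator_summ I (r : seq I) (P : pred I) (f : I -> A) v w :
  associator v (\sum_(i <- r | P i) f i) w
  = \sum_(i <- r | P i) associator v (f i) w.
Proof. by rewrite /associator nmul_sumr !nmul_suml nmul_sumr sumrB. Qed.

Lemma associator_sumr I (r : seq I) (P : pred I) (f : I -> A) v w :
  associator v w (\sum_(i <- r | P i) f i)
  = \sum_(i <- r | P i) associator v w (f i).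
Proof. by rewrite /associator !nmul_sumr sumrB. Qed.

End NalgBasics.

#[global] Arguments nmul : simpl never.

(** * The Galois group of a finite extension *)

Lemma galZ (F : fieldType) (L : splittingFieldType F) (s : gal_of {:L}) (c : F) x :
  s (c *: x) = c *: s x.
Proof. exact: linearZ. Qed.

Section Galois.
Variables (F : finFieldType) (L : splittingFieldType F).
Local Notation m := (\dim {:L}).
Implicit Types (s : gal_of {:L}) (x : L).

Lemma dim_gt0 : (0 < m)%N.
Proof. exact: adim_gt0. Qed.

Lemma galois_over_base : galois 1%AS {:L}%AS.
Proof. exact/finField_galois/sub1v. Qed.

Lemma mem_gal_base s : s \in 'Gal({:L} / 1)%g.
Proof. by rewrite gal_kAut ?sub1v // kAutfE k1AHom. Qed.

Lemma card_gal_base : #|'Gal({:L} / 1)%g| = m.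
Proof. by rewrite -(galois_dim galois_over_base) dimv1 divn1. Qed.

Lemma cyclic_gal_base : cyclic 'Gal({:L} / 1).
Proof.
have [alpha gen_alpha _] := finField_galois_generator (sub1v {:L}%AS).
by apply/cyclicP; exists alpha; apply/eqP.
Qed.

Lemma gal_iter n s x : iter n s x = (s ^+ n)%g x.
Proof.
elim: n => [|n IHn]; first by rewrite gal_id.
by rewrite expgSr galM ?memvf //= IHn.
Qed.

Lemma iter_dim s x : iter m s x = x.
Proof. by rewrite gal_iter -card_gal_base expg_cardG ?mem_gal_base ?gal_id. Qed.

Lemma iter_mod n s x : iter (n %% m) s x = iter n s x.
Proof. by rewrite !gal_iter -card_gal_base expg_mod // expg_cardG ?mem_gal_base. Qed.

(** The fixed field of a generator is that of the whole group, which is the base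
    field because an extension of finite fields is Galois. *)
Lemma fixed_generator s x :
  generator 'Gal({:L} / 1) s -> (x \in 1%VS) = (s x == x).
Proof.
move=> gen_s; have <-: fixedField 'Gal({:L} / 1)%g = 1%AS.
  exact/galois_fixedField/galois_over_base.
apply/(fixedFieldP (memvf x))/eqP => [fix_x|fix_x t].
  by apply: fix_x; rewrite mem_gal_base.
rewrite (eqP gen_s) => /cycleP[i ->]; rewrite -gal_iter.
by elim: i => //= i ->.
Qed.

Lemma gal_inj s : injective s.
Proof. by move=> x y; apply: fmorph_inj. Qed.

(** The Galois group is cyclic, hence commutative. *)
Lemma gal_comm s (t : gal_of {:L}) x : s (t x) = t (s x).
Proof.
rewrite -!galM ?memvf //; congr (gal_repr _ x).
have /centsP := cyclic_abelian cyclic_gal_base.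
by apply; exact: mem_gal_base.
Qed.

Lemma iter_galX n s x e : iter n s (x ^+ e) = iter n s x ^+ e.
Proof. by elim: n => //= n ->; rewrite rmorphXn. Qed.

Lemma iter_gal0 n s : iter n s 0 = 0.
Proof. by elim: n => //= n ->; rewrite rmorph0. Qed.

Lemma iter_gal1 n s : iter n s 1 = 1.
Proof. by elim: n => //= n ->; rewrite rmorph1. Qed.

Lemma iter_galM n s x y : iter n s (x * y) = iter n s x * iter n s y.
Proof. by elim: n => //= n ->; rewrite rmorphM. Qed.

Lemma iter_gal_eq0 n s x : (iter n s x == 0) = (x == 0).
Proof. by elim: n => //= n IHn; rewrite fmorph_eq0. Qed.

Lemma iter_gal_inj n s : injective (iter n s).
Proof. by elim: n => //= n IHn x y /gal_inj/IHn. Qed.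

End Galois.

(** * Coordinates on the algebra *)

Section Coordinates.
Variables (F : finFieldType) (L : splittingFieldType F).
Local Notation m := (\dim {:L}).
Local Notation V := (petit_space L m).
Implicit Types (v w : V) (x y : L).

Definition xcoord v (k : nat) : L := (polyn (v : {poly_m L}))`_k.

Definition of_coord (c : nat -> L) : V := mk_npoly m c.

Definition monomial x j : V := of_coord (fun k => if k == j then x else 0).
Local Notation mono := monomial.

Lemma coord_of c k : xcoord (of_coord c) k = if (k < m)%N then c k else 0.
Proof. by rewrite /xcoord coef_poly. Qed.

Lemma coordP v w : (forall k, (k < m)%N -> xcoord v k = xcoord w k) -> v = w.
Proof.
move=> eq_vw; apply/val_inj/polyP => k.
have [/eq_vw //|le_mk] := ltnP k m.
by rewrite !nth_default // (leq_trans (size_npoly _)).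
Qed.

Lemma coord_ge v k : (m <= k)%N -> xcoord v k = 0.
Proof. by move=> le_mk; rewrite /xcoord nth_default // (leq_trans (size_npoly _)). Qed.

Lemma coordD v w k : xcoord (v + w) k = xcoord v k + xcoord w k.
Proof. exact: coefD. Qed.
Lemma coordN v k : xcoord (- v) k = - xcoord v k.
Proof. exact: coefN. Qed.
Lemma coord0 k : xcoord 0 k = 0.
Proof. exact: coef0. Qed.
Lemma coordZ (c : F) v k : xcoord (c *: v) k = c *: xcoord v k.
Proof. by rewrite -[RHS]mulr_algl; exact: coefZ. Qed.
Lemma coord_sum I (r : seq I) (P : pred I) (f : I -> V) k :
  xcoord (\sum_(i <- r | P i) f i) k = \sum_(i <- r | P i) xcoord (f i) k.
Proof. by rewrite (big_morph (xcoord ^~ k) (fun v w => coordD v w k) (coord0 k)). Qed.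

Lemma coord_mono x j k :
  xcoord (mono x j) k = if (k < m)%N && (k == j) then x else 0.
Proof. by rewrite coord_of; case: ltnP. Qed.

Lemma mono0 j : mono 0 j = 0.
Proof. by apply: coordP => k _; rewrite coord_mono coord0 if_same. Qed.
Lemma monoD x y j : mono (x + y) j = mono x j + mono y j.
Proof.
by apply: coordP => k _; rewrite coordD !coord_mono; case: ifP; rewrite ?addr0.
Qed.
Lemma monoZ (c : F) x j : mono (c *: x) j = c *: mono x j.
Proof.
by apply: coordP => k _; rewrite coordZ !coord_mono; case: ifP; rewrite ?scaler0.
Qed.

Lemma coord_mono_sum (c : nat -> L) k : (k < m)%N ->
  xcoord (\sum_(i < m) mono (c i) i) k = c k.
Proof.
move=> lt_km; rewrite coord_sum (bigD1 (Ordinal lt_km)) //=.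
rewrite coord_mono lt_km eqxx big1 ?addr0 // => i ne_ik.
move: ne_ik; rewrite -(inj_eq val_inj) eq_sym /= => /negPf ne_ki.
by rewrite coord_mono ne_ki andbF.
Qed.

Lemma mono_sum v : v = \sum_(i < m) mono (xcoord v i) i.
Proof. by apply: coordP => k lt_km; rewrite (coord_mono_sum (xcoord v)). Qed.

Lemma mono_eq0 x j : (j < m)%N -> (mono x j == 0) = (x == 0).
Proof.
move=> lt_jm; apply/eqP/eqP => [/(congr1 (xcoord ^~ j))|->]; last exact: mono0.
by rewrite coord_mono coord0 lt_jm eqxx.
Qed.

Lemma mono_inj x y j : (j < m)%N -> mono x j = mono y j -> x = y.
Proof.
by move=> lt_jm /(congr1 (xcoord ^~ j)); rewrite !coord_mono lt_jm eqxx.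
Qed.
End Coordinates.

(** * Products and associators of monomials *)

Section MonomialProducts.
Variables (F : finFieldType) (L : splittingFieldType F).
Variables (s : gal_of {:L}) (a : L).
Local Notation m := (\dim {:L}).
Local Notation V := (petit_space L m).
Local Notation A := (petit L s a).
Local Notation mono x j := (monomial x j%N : A).
Implicit Types (u v w : A) (x y z : L).

(** The coefficient by which X^n reduces to X^(n mod m) modulo X^m - a.  The form
    s^n(a) rather than s^(n mod m)(a) is the same by s^m = 1, and composes without
    case analysis on the carries. *)
Definition power_coef n := iter n s a ^+ (n %/ m).

Lemma skew_mul_mono x y i j :
  skew_mul s (x *: 'X^i) (y *: 'X^j) = (x * iter i s y) *: 'X^(i + j).
Proof.
apply/polyP => k; rewrite coef_skew_mul coefZ coefXn.
have [->|ne_k] := eqVneq k (i + j)%N.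
  have lt_i : (i < (i + j).+1)%N by rewrite ltnS leq_addr.
  rewrite (bigD1 (Ordinal lt_i)) //= big1 => [|l ne_l].
    by rewrite !coefZ !coefXn addKn !eqxx !mulr1 addr0.
  rewrite coefZ coefXn; case: eqP => [l_i|]; last by rewrite mulr0 mul0r.
  by rewrite -(inj_eq val_inj) /= l_i eqxx in ne_l.
rewrite mulr0 big1 // => l _; rewrite !coefZ !coefXn.
case: eqP => [li|]; last by rewrite mulr0 mul0r.
case: eqP => [kl|]; last by rewrite !mulr0 iter_s0 mulr0.
by case/eqP: ne_k; rewrite -kl li subnKC // -ltnS -li.
Qed.

Lemma polyn_mono x j : (j < m)%N -> polyn (mono x j : {poly_m L}) = x *: 'X^j.
Proof.
move=> lt_jm; apply/polyP => k; rewrite coef_poly coefZ coefXn.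
have [->|ne_kj] := eqVneq k j; first by rewrite lt_jm mulr1.
by rewrite mulr0 if_same.
Qed.

(** If i + j < m no reduction takes place.  Otherwise, with r = i + j - m, the
    identity X^(r + m) = X^r (X^m - a) + s^r(a) X^r exhibits the remainder. *)
Lemma mul_mono x y i j : (i < m)%N -> (j < m)%N ->
  nmul (mono x i) (mono y j) =
  mono (x * iter i s y * power_coef (i + j)%N) ((i + j) %% m)%N.
Proof.
move=> lt_im lt_jm; apply: val_inj; rewrite /= petit_mulE.
rewrite !polyn_mono ?ltn_mod ?dim_gt0 //.
have mon : 'X^m - a%:P \is monic by rewrite monicXnsubC ?dim_gt0.
rewrite skew_mul_mono /power_coef; have [lt_m|le_m] := ltnP (i + j)%N m.
  rewrite divn_small // modn_small // mulr1 -[in LHS](add0r (_ *: _)).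
  rewrite -(_ : skew_mul s 0 ('X^m - a%:P) = 0) ?skew_rmod_uniq //.
    by rewrite (leq_ltn_trans (size_scale_leq _ _)) // size_polyXn size_XnsubC ?dim_gt0.
  by rewrite -[0](scale0r 0) skew_mulZl !scale0r.
have lt_r : (i + j - m < m)%N by lia.
set r := (i + j - m)%N in lt_r *; have -> : (i + j = r + m)%N by rewrite subnK.
rewrite divnDr ?dvdnn // divnn dim_gt0 divn_small // modnDr modn_small // expr1.
rewrite iterD iter_dim; set c := x * _; set d := 'X^m - a%:P.
rewrite -(_ : skew_mul s (c *: 'X^r) d + (c * iter r s a) *: 'X^r = c *: 'X^(r + m)).
  rewrite skew_rmod_uniq // (leq_ltn_trans (size_scale_leq _ _)) //.
  by rewrite size_polyXn size_XnsubC ?dim_gt0.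
have -> : (c * iter r s a) *: 'X^r = skew_mul s (c *: 'X^r) a%:P.
  by rewrite -[a%:P]alg_polyC -(expr0 'X) skew_mul_mono addn0.
by rewrite -skew_mulDr subrK -['X^m]scale1r skew_mul_mono iter_s1 mulr1.
Qed.

(** The two bracketings of X^i X^j X^k both pick up the conjugate s^(i+j+k)(a) at
    each reduction, except that reducing X^i X^j first yields the conjugate
    s^(i+j)(a), because that coefficient stands to the left of X^k. *)
Definition assoc_coef i j k :=
  let b := a ^+ ((i + j) %/ m) in
  (iter (i + j) s b - iter (i + j + k) s b)
  * iter (i + j + k) s a ^+ (((i + j) %% m + k) %/ m).

(** Carries add up: this makes the number of reductions in a product of three
    monomials independent of the bracketing. *)
Lemma divn_modDl i k : (i %/ m + (i %% m + k) %/ m = (i + k) %/ m)%N.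
Proof. by rewrite {3}(divn_eq i m) -addnA divnMDl ?dim_gt0. Qed.

Lemma power_coef_modl i k :
  power_coef (i %% m + k) = iter (i + k) s a ^+ ((i %% m + k) %/ m).
Proof. by rewrite /power_coef -iter_mod modnDml iter_mod. Qed.

Lemma assoc_mono x y z i j k : (i < m)%N -> (j < m)%N -> (k < m)%N ->
  associator (mono x i) (mono y j) (mono z k) =
  mono (x * iter i s y * iter (i + j)%N s z * assoc_coef i j k)
       ((i + j + k) %% m)%N.
Proof.
move=> lt_i lt_j lt_k; rewrite /associator !mul_mono ?ltn_mod ?dim_gt0 //.
rewrite modnDml modnDmr addnA -[- _]scaleN1r -monoZ -monoD; congr (monomial _ _).
rewrite (addnC i (_ %% _)%N) !power_coef_modl /power_coef /assoc_coef /=.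
rewrite !(iter_galM, iter_galX) iter_mod -!iterD (addnC _ i) addnA.
set X := iter (i + j) s a; set Y := iter (i + j + k) s a.
have eqY : Y ^+ ((i + j) %/ m) * Y ^+ (((i + j) %% m + k) %/ m)
    = Y ^+ ((j + k) %/ m) * Y ^+ (((j + k) %% m + i) %/ m).
  by rewrite -!exprD !divn_modDl; congr (_ ^+ (_ %/ _)); lia.
rewrite [_ * _ * X ^+ _]mulrAC -!mulrA -eqY scaleN1r; ring.
Qed.
End MonomialProducts.

(** * Nuclei and center *)

Section Nuclei.
Variables (F : finFieldType) (L : splittingFieldType F).
Variables (s : gal_of {:L}) (a : L).
Local Notation m := (\dim {:L}).
Local Notation A := (petit L s a).
Local Notation mono x j := (monomial x j%N : A).
Implicit Types (u v w : A) (x y z : L).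

Lemma coord_ordP v w : (forall i : 'I_m, xcoord v i = xcoord w i) -> v = w.
Proof. by move=> eq_vw; apply: coordP => k lt_km; apply: (eq_vw (Ordinal lt_km)). Qed.

(** Degrees shifted by r modulo m stay pairwise distinct, so a relation between
    shifted monomials can be read coefficient by coefficient. *)
Lemma coord_shift (c : nat -> L) r i : (i < m)%N ->
  xcoord (\sum_(j < m) monomial (c j) ((j + r) %% m)%N) ((i + r) %% m)%N = c i.
Proof.
move=> lt_im; rewrite coord_sum (bigD1 (Ordinal lt_im)) //= coord_mono eqxx.
rewrite ltn_mod dim_gt0 /= big1 ?addr0 // => j ne_ji; rewrite coord_mono.
rewrite ltn_mod dim_gt0 eqn_modDr !modn_small //.
move: ne_ji; rewrite -(inj_eq val_inj) eq_sym /=.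
by move/negPf->.
Qed.

Lemma assoc_coef_small i j k : (i + j < m)%N -> assoc_coef s a i j k = 0.
Proof.
by move=> lt_m; rewrite /assoc_coef divn_small // expr0 !iter_gal1 subrr mul0r.
Qed.

Lemma assoc_coef_neq0 i j k : (i < m)%N -> (j < m)%N -> (m <= i + j)%N ->
  iter k s a != a -> assoc_coef s a i j k != 0.
Proof.
move=> lt_im lt_jm le_m ne_a.
have nz_a : a != 0 by apply: contraNneq ne_a => ->; rewrite iter_gal0.
rewrite /assoc_coef mulf_neq0 ?expf_neq0 ?iter_gal_eq0 // subr_eq0.
have -> : ((i + j) %/ m = 1)%N.
  by rewrite -(subnK le_m) divnDr ?dvdnn // divnn dim_gt0 divn_small //; lia.
by rewrite expr1 (iterD (i + j) k) (inj_eq (@iter_gal_inj _ _ _ _)) eq_sym.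
Qed.

Lemma constant_mul x y j : (j < m)%N -> nmul (mono x 0) (mono y j) = mono (x * y) j.
Proof.
move=> lt_jm; rewrite mul_mono ?dim_gt0 // add0n /power_coef divn_small // mulr1.
by rewrite modn_small.
Qed.

Lemma mul_constant x y j : (j < m)%N ->
  nmul (mono y j) (mono x 0) = mono (y * iter j s x) j.
Proof.
move=> lt_jm; rewrite mul_mono ?dim_gt0 // addn0 /power_coef divn_small // mulr1.
by rewrite modn_small.
Qed.

Lemma coord_constant_mul x v i : xcoord (nmul (mono x 0) v) i = x * xcoord v i.
Proof.
have [lt_im|le_mi] := ltnP i m; last by rewrite !coord_ge ?mulr0.
rewrite {1}(mono_sum v) nmul_sumr; under eq_bigr => j _ do rewrite constant_mul //.
by rewrite (coord_mono_sum (fun j => x * xcoord v j)).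
Qed.

Lemma unit_one : is_unit_of (mono 1 0).
Proof.
move=> v; split; first by apply: coord_ordP => i; rewrite coord_constant_mul mul1r.
rewrite {1}(mono_sum v) nmul_suml [RHS]mono_sum; apply: eq_bigr => j _.
by rewrite mul_constant // iter_gal1 mulr1.
Qed.

(** The first product in the associator involves a factor of degree 0, so it does
    not wrap around. *)
Lemma constant_left_nucleus x : left_nucleus (mono x 0).
Proof.
move=> v w; rewrite (mono_sum v) (mono_sum w) associator_summ big1 // => i _.
rewrite associator_sumr big1 // => j _.
by rewrite assoc_mono ?dim_gt0 // assoc_coef_small ?add0n // mulr0 mono0.
Qed.

Lemma constant_middle_nucleus x : middle_nucleus (mono x 0).
Proof.
move=> v w; rewrite (mono_sum v) (mono_sum w) associator_suml big1 // => i _.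
rewrite associator_sumr big1 // => j _.
by rewrite assoc_mono ?dim_gt0 // assoc_coef_small ?addn0 // mulr0 mono0.
Qed.

(** Here the coefficient vanishes because s^0 fixes a. *)
Lemma constant_right_nucleus x : right_nucleus (mono x 0).
Proof.
move=> v w; rewrite (mono_sum v) (mono_sum w) associator_suml big1 // => i _.
rewrite associator_summ big1 // => j _.
by rewrite assoc_mono ?dim_gt0 // /assoc_coef addn0 subrr mul0r mulr0 mono0.
Qed.

Lemma constantP v : (forall i, (0 < i < m)%N -> xcoord v i = 0) ->
  v = mono (xcoord v 0%N) 0.
Proof.
move=> v0; apply: coord_ordP => -[[|i] lt_im]; rewrite /= coord_mono lt_im //=.
exact: v0.
Qed.

Hypotheses (m_gt1 : (1 < m)%N) (sa : s a != a).

(** Testing against X^(m - i) and X isolates the coordinate i > 0: that product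
    wraps around, and s moves a, so the coordinate must be zero. *)
Lemma left_nucleusP v : left_nucleus v <-> exists x, v = mono x 0.
Proof.
split=> [nuc_v|[x ->]]; last exact: constant_left_nucleus.
exists (xcoord v 0%N); apply: constantP => i /andP[i_gt0 lt_im].
have lt_mi : (m - i < m)%N by lia.
have := nuc_v (mono 1 (m - i)) (mono 1 1).
rewrite {1}(mono_sum v) associator_suml; under eq_bigr => j _.
  rewrite assoc_mono //.
  rewrite !iter_gal1 !mulr1 -addnA; over.
move/(congr1 (fun w => xcoord w ((i + (m - i + 1)) %% m))).
rewrite (coord_shift (fun j => xcoord v j * assoc_coef s a j (m - i) 1)) // coord0.
move/eqP; rewrite mulf_eq0 (negPf (assoc_coef_neq0 _ _ _ _)) ?orbF //; try lia.
by move/eqP.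
Qed.

Lemma middle_nucleusP v : middle_nucleus v <-> exists x, v = mono x 0.
Proof.
split=> [nuc_v|[x ->]]; last exact: constant_middle_nucleus.
exists (xcoord v 0%N); apply: constantP => i /andP[i_gt0 lt_im].
have lt_mi : (m - i < m)%N by lia.
have := nuc_v (mono 1 (m - i)) (mono 1 1).
rewrite {1}(mono_sum v) associator_summ; under eq_bigr => j _.
  rewrite assoc_mono //.
  rewrite !iter_gal1 mul1r mulr1 (addnC (m - i)%N) -addnA; over.
move/(congr1 (fun w => xcoord w ((i + (m - i + 1)) %% m))).
pose c j := iter (m - i) s (xcoord v j) * assoc_coef s a (m - i) j 1.
rewrite (coord_shift c) // coord0 /c.
move/eqP; rewrite mulf_eq0 iter_gal_eq0 (negPf (assoc_coef_neq0 _ _ _ _)) ?orbF //; try lia.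
by move/eqP.
Qed.

(** Testing against X^(m - 1) and X always wraps around, so that the coordinate
    k > 0 of an element of the right nucleus is killed if s^k moves a.  When some
    s^k with 0 < k < m fixes a, the right nucleus is larger. *)
Lemma right_nucleusP v : (forall i, (0 < i < m)%N -> iter i s a != a) ->
  right_nucleus v <-> exists x, v = mono x 0.
Proof.
move=> distinct_a.
split=> [nuc_v|[x ->]]; last exact: constant_right_nucleus.
exists (xcoord v 0%N); apply: constantP => i lt_i; have [i_gt0 lt_im] := andP lt_i.
have lt_m1 : (m - 1 < m)%N by lia.
have := nuc_v (mono 1 (m - 1)) (mono 1 1).
rewrite {1}(mono_sum v) associator_sumr; under eq_bigr => j _.
  rewrite assoc_mono //.
  rewrite !iter_gal1 !mul1r (addnC (m - 1 + 1)%N); over.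
move/(congr1 (fun w => xcoord w ((i + (m - 1 + 1)) %% m))).
pose c j := iter (m - 1 + 1) s (xcoord v j) * assoc_coef s a (m - 1) 1 j.
rewrite (coord_shift c) // coord0 /c.
move/eqP; rewrite mulf_eq0 iter_gal_eq0.
rewrite (negPf (assoc_coef_neq0 _ _ _ _)) ?orbF ?distinct_a //; try lia.
by move/eqP.
Qed.

(** A constant commutes with X exactly when s fixes it. *)
Lemma centerP v : generator 'Gal({:L} / 1) s ->
  Defs.center v <-> exists c : F, v = c *: mono 1 0.
Proof.
move=> gen_s; split=> [[/left_nucleusP[x ->] _ _ comm]|[c ->]].
  have := comm (mono 1 1); rewrite constant_mul // mul_constant // mulr1 mul1r.
  move/(mono_inj m_gt1)/esym/eqP; rewrite -fixed_generator // => /vlineP[c ->].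
  by exists c; rewrite monoZ.
rewrite -monoZ; split; [exact: constant_left_nucleus|exact: constant_middle_nucleus
  |exact: constant_right_nucleus|].
move=> w; rewrite (mono_sum w) nmul_sumr nmul_suml; apply: eq_bigr => i _.
rewrite constant_mul // mul_constant // mulrC; congr (monomial (_ * _) _).
by rewrite gal_iter rmorph_alg.
Qed.

End Nuclei.

(** * The division property *)

Section Division.
Variables (F : finFieldType) (L : splittingFieldType F).
Variables (s : gal_of {:L}) (a : L).
Local Notation m := (\dim {:L}).
Local Notation V := (petit_space L m).
Local Notation A := (petit L s a).
Local Notation mono x j := (monomial x j%N : A).
Implicit Types (g h u v w : A) (x y z : L).

(** The space is that of polynomials of bounded degree over a finite field: viewing
    K as a finite type makes it a finite type on the same carrier. *)
Lemma petit_space_inj_bij (f : V -> V) : injective f -> bijective f.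
Proof. exact: (@injF_bij {poly_m (finvect_type L)}). Qed.

Lemma petit_space_surj_inj (f : V -> V) : (forall w, exists v, w = f v) -> injective f.
Proof.
pose T : finType := {poly_m (finvect_type L)}.
move=> surj_f; have: #|image (f : T -> T) T| == #|T|.
  rewrite eqn_leq max_card; apply: subset_leq_card; apply/subsetP=> w _.
  by have [v ->] := surj_f w; apply: image_f.
by move/image_injP => inj_f x y; apply: inj_f.
Qed.

Lemma card_extension : #|finvect_type L| = (#|F| ^ m)%N.
Proof.
have <-: #|(fullv : {vspace finvect_type L})| = #|finvect_type L|.
  by apply: eq_card => x; rewrite memvf.
by rewrite card_vspace.
Qed.

Lemma card_petit_space : #|{poly_m (finvect_type L)}| = (#|F| ^ (m ^ 2))%N.
Proof. by rewrite card_npoly card_extension -expnM. Qed.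

Hypothesis m_gt1 : (1 < m)%N.

Definition mulX v : A := nmul (mono 1 1) v.

Lemma iter_mulX_mono n x j : (j < m)%N ->
  iter n mulX (mono x j) = mono (iter n s x * power_coef s a (n + j)) ((n + j) %% m).
Proof.
move=> lt_jm; elim: n => [|n IHn].
  by rewrite add0n /power_coef divn_small // mulr1 modn_small.
rewrite iterS IHn /mulX mul_mono ?ltn_mod ?dim_gt0 // modnDmr mul1r.
congr (monomial _ _); rewrite (addnC 1%N) power_coef_modl /= rmorphM -mulrA.
rewrite /power_coef rmorphXn /= -iterS addn1 -exprD divn_modDl.
by rewrite !addSn addn1.
Qed.

Lemma iter_mulX_sum n v :
  iter n mulX v = \sum_(j < m) iter n mulX (mono (xcoord v j) j).
Proof.
rewrite {1}(mono_sum v); elim: n => //= n ->.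
by rewrite /mulX nmul_sumr.
Qed.

(** The m-th iterate of multiplication by X is diagonal in the monomial basis, with
    the conjugates of a as eigenvalues. *)
Lemma coord_iter_mulX v i : xcoord (iter m mulX v) i = xcoord v i * iter i s a.
Proof.
have [lt_im|le_mi] := ltnP i m; last by rewrite !coord_ge ?mul0r.
rewrite iter_mulX_sum -(coord_mono_sum (fun j => xcoord v j * iter j s a)) //.
congr (xcoord _ i); apply: eq_bigr => j _.
rewrite iter_mulX_mono // modnDl modn_small // iter_dim; congr (monomial (_ * _) _).
rewrite /power_coef divnDl // divnn dim_gt0 divn_small // expr1.
by rewrite -(iter_mod (m + j)) modnDl modn_small.
Qed.

Lemma coord_mulXS v i : (i.+1 < m)%N -> xcoord (mulX v) i.+1 = s (xcoord v i).
Proof.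
move=> lt_im; have lt_im' := ltnW lt_im.
rewrite {1}(mono_sum v) /mulX nmul_sumr coord_sum (bigD1 (Ordinal lt_im')) //=.
rewrite mul_mono // coord_mono add1n modn_small // lt_im eqxx /power_coef divn_small //.
rewrite mulr1 mul1r big1 ?addr0 // => j ne_ji.
rewrite mul_mono // coord_mono lt_im; case: eqP => // eq_ij.
case/eqP: ne_ji; apply: val_inj => /=; move: eq_ij; rewrite add1n.
have [lt_jm|le_mj] := ltnP j.+1 m; first by rewrite modn_small // => -[].
have -> : j.+1 = m by apply/eqP; rewrite eqn_leq le_mj ltn_ord.
by rewrite modnn.
Qed.

Hypothesis distinct_a : forall i, (0 < i < m)%N -> iter i s a != a.

Lemma distinct_conjugates i j : (i < j < m)%N -> iter i s a != iter j s a.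
Proof.
move=> /andP[lt_ij lt_jm]; rewrite -(subnKC (ltnW lt_ij)) iterD.
by rewrite (inj_eq (@iter_gal_inj _ _ _ _)) eq_sym distinct_a //; lia.
Qed.

(** If g h = 0 with g of degree d, the products u h with u of degree less than d form
    a subspace stable under multiplication by X.  A nonzero such subspace is a sum
    of eigenlines that X permutes cyclically, hence everything; but then
    u -> u h is onto without being injective. *)
Lemma petit_integral g h : nmul g h = 0 -> g = 0 \/ h = 0.
Proof.
move=> gh0; case: (eqVneq g 0) => [|nz_g]; [by left|].
case: (eqVneq h 0) => [|nz_h]; [by right|exfalso].
have nz_a : a != 0.
  by apply: contraNneq (@distinct_a 1%N m_gt1) => ->; rewrite iter_gal0.
pose d := (size (polyn (g : {poly_m L}))).-1.
have nz_pg : polyn (g : {poly_m L}) != 0 by [].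
have lt_dm : (d < m)%N.
  by rewrite /d prednK ?size_poly_gt0 // size_npoly.
have nz_gd : xcoord g d != 0 by rewrite /xcoord lead_coef_eq0.
have g_gt i : (d < i)%N -> xcoord g i = 0.
  by move=> lt_di; rewrite /xcoord nth_default // -(prednK (n := size _)) ?size_poly_gt0.
(* W is spanned by h, X h, ..., X^(d-1) h. *)
pose low u := forall i, (d <= i)%N -> xcoord u i = 0.
pose W w := exists2 u, low u & w = nmul u h.
have WD u w : W u -> W w -> W (u + w).
  move=> [u1 low1 ->] [u2 low2 ->]; exists (u1 + u2); rewrite ?nmulDl // => i le_di.
  by rewrite coordD low1 ?low2 ?addr0.
have WZ x w : W w -> W (nmul (mono x 0) w).
  move=> [u lowu ->]; exists (nmul (mono x 0) u).
    by move=> i le_di; rewrite coord_constant_mul lowu ?mulr0.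
  by apply/esym/eqP; rewrite -subr_eq0; apply/eqP/constant_left_nucleus.
have W0 : W 0 by exists 0; [move=> i _; rewrite coord0 | rewrite nmul0l].
have WmulX w : W w -> W (mulX w).
  move=> [u lowu ->]; pose c := xcoord (mulX u) d / xcoord g d.
  (* X u has degree at most d; subtracting c g, which kills h, lowers it. *)
  exists (mulX u - nmul (mono c 0) g).
    move=> i; rewrite coordD coordN coord_constant_mul leq_eqVlt.
    case/orP=> [/eqP<-|lt_di]; first by rewrite divfK ?subrr.
    rewrite g_gt // mulr0 subr0; case: i lt_di => // i le_di.
    have [lt_im|le_mi] := ltnP i.+1 m; last by rewrite coord_ge.
    by rewrite coord_mulXS // lowu ?rmorph0.
  rewrite nmulBl.
  have -> : nmul (nmul (mono c 0) g) h = 0.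
    have /eqP := @constant_left_nucleus _ _ s a c g h.
    by rewrite subr_eq0 gh0 nmul0r => /eqP.
  rewrite subr0; apply/esym/eqP; rewrite -subr_eq0.
  rewrite -/(associator (mono 1 1) u h) {1}(mono_sum u) (mono_sum h).
  rewrite associator_summ big1 // => i _; rewrite associator_sumr big1 // => j _.
  have [lt_id|le_di] := ltnP i d; last first.
    by rewrite lowu // mono0 /associator nmul0r !nmul0l nmul0r subr0.
  by rewrite assoc_mono // assoc_coef_small ?mulr0 ?mono0 // add1n (leq_ltn_trans lt_id).
have Witer n w : W w -> W (iter n mulX w) by move=> Ww; elim: n => //= n /WmulX.
have [w nz_w Ww] : exists2 w, w != 0 & W w.
  have [d0|d_gt0] := posnP d; last first.
    exists h => //; exists (mono 1 0); last by case: (@unit_one _ _ s a h).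
    by move=> [|i]; rewrite leqNgt ?d_gt0 // coord_mono andbF.
  case/eqP: nz_h; apply: coord_ordP => i.
  have g0 : g = mono (xcoord g d) 0.
    by rewrite d0; apply: constantP => j; rewrite -d0 => /andP[/g_gt].
  have := congr1 (fun w : A => xcoord w i) gh0; rewrite g0 coord_constant_mul !coord0.
  by move/eqP; rewrite mulf_eq0 (negPf nz_gd) => /eqP.
have [e lt_em We] : exists2 e, (e < m)%N & W (mono 1 e).
  have : forall i, (m <= i)%N -> xcoord w i = 0 by move=> i; apply: coord_ge.
  (* Induction on the number n of possibly nonzero coordinates of w: subtracting
     s^n(a) w from X^m w removes the top one and rescales the others. *)
  elim: {-2 4}m (leqnn m) w nz_w Ww => [|n IHn] lt_nm w nz_w Ww wn0.
    by case/eqP: nz_w; apply: coord_ordP => i; rewrite coord0 wn0.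
  have [wn|nz_wn] := eqVneq (xcoord w n) 0.
    apply: (IHn (ltnW lt_nm) w nz_w Ww) => i; rewrite leq_eqVlt.
    by case/orP => [/eqP<-//|]; apply: wn0.
  pose w' := iter m mulX w + nmul (mono (- iter n s a) 0) w.
  have co_w' i : xcoord w' i = xcoord w i * (iter i s a - iter n s a).
    by rewrite coordD coord_iter_mulX coord_constant_mul; ring.
  have Ww' : W w' by apply: WD; [apply: Witer | apply: WZ].
  have w'0 i : (n <= i)%N -> xcoord w' i = 0.
    rewrite leq_eqVlt co_w' => /orP[/eqP<-|/wn0->]; last by rewrite mul0r.
    by rewrite subrr mulr0.
  have [w'_eq0|nz_w'] := eqVneq w' 0; last exact: (IHn (ltnW lt_nm) w').
  exists n => //; have -> : mono 1 n = nmul (mono (xcoord w n)^-1 0) w; last exact: WZ.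
  apply: coord_ordP => i; rewrite coord_constant_mul coord_mono ltn_ord /=.
  case: (ltngtP i n) => [lt_in|lt_ni|->]; last by rewrite mulVf.
    have /eqP := congr1 (fun w : A => xcoord w i) w'_eq0; rewrite co_w' coord0 mulf_eq0.
    rewrite subr_eq0 (negPf (distinct_conjugates _)) ?lt_in //.
    by rewrite orbF => /eqP->; rewrite mulr0.
  by rewrite (wn0 i) ?mulr0.
have Wmono x j : (j < m)%N -> W (mono x j).
  move=> lt_jm; have := Witer (m - e + j)%N _ We.
  rewrite iter_mulX_mono // iter_gal1 mul1r.
  have -> : (m - e + j + e = m + j)%N by lia.
  rewrite modnDl modn_small // => /(WZ (x / power_coef s a (m + j))).
  by rewrite constant_mul // divfK // /power_coef expf_neq0 // iter_gal_eq0.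
have Wall v : W v.
  rewrite (mono_sum v); elim/big_ind: _ => // j _; exact: Wmono.
have inj_h : injective (fun u : A => nmul u h).
  by apply: petit_space_surj_inj => v; have [u _ def_v] := Wall v; exists u.
(* X^d h is also u h with u of degree less than d, against injectivity. *)
have [u lowu /esym/inj_h eq_u] := Wall (nmul (mono 1 d) h).
have := lowu d (leqnn d); rewrite eq_u coord_mono lt_dm eqxx.
by move/eqP; rewrite oner_eq0.
Qed.

(** Without zero divisors the multiplications are injective, hence bijective. *)
Lemma petit_semifield : semifield A.
Proof.
split; first by exists (mono 1 0); apply: unit_one.
split; first by exists (mono 1 0); rewrite mono_eq0 ?dim_gt0 ?oner_eq0.
move=> v nz_v; split; apply: petit_space_inj_bij => u w eq_uw; apply/eqP.
  have /petit_integral[v0|/eqP] : nmul v (u - w : A) = 0.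
  - by rewrite nmulBr (eq_uw : nmul v (u : A) = nmul v (w : A)) subrr.
  - by rewrite v0 eqxx in nz_v.
  - by rewrite subr_eq0.
have /petit_integral[/eqP|v0] : nmul (u - w : A) v = 0.
- by rewrite nmulBl (eq_uw : nmul (u : A) v = nmul (w : A) v) subrr.
- by rewrite subr_eq0.
- by rewrite v0 eqxx in nz_v.
Qed.
End Division.

(** * Norms as twisted powers *)

Section TwistedNorm.
Variables (F : finFieldType) (L : splittingFieldType F).
Local Notation m := (\dim {:L}).
Implicit Types (s t : gal_of {:L}) (x k : L).

Lemma order_generator s : generator 'Gal({:L} / 1) s -> #[s]%g = m.
Proof. by move=> gen_s; rewrite -card_gal_base /order -(eqP gen_s). Qed.

Lemma generator_expg_inj s i j : generator 'Gal({:L} / 1) s ->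
  (i < m)%N -> (j < m)%N -> (forall x, iter i s x = iter j s x) -> i = j.
Proof.
move=> gen_s lt_im lt_jm eq_ij; have /eqP: (s ^+ i = s ^+ j)%g.
  by apply/eqP/gal_eqP => x _; rewrite -!gal_iter.
by rewrite eq_expg_mod_order order_generator // !modn_small // => /eqP.
Qed.

(** In twisted polynomials, (k X)^n = partial_norm s n k * X^n. *)
Definition partial_norm s n k := \prod_(i < n) iter i s k.

Lemma partial_normS s n k : partial_norm s n.+1 k = partial_norm s n k * iter n s k.
Proof. by rewrite /partial_norm big_ord_recr. Qed.

Lemma partial_normD s i j k :
  partial_norm s (i + j) k = partial_norm s i k * iter i s (partial_norm s j k).
Proof.
elim: j => [|j IHj].
  by rewrite addn0 /partial_norm big_ord0 iter_gal1 mulr1.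
by rewrite addnS !partial_normS IHj iter_galM -iterD mulrA.
Qed.

Lemma partial_norm_neq0 s n k : k != 0 -> partial_norm s n k != 0.
Proof. by move=> nz_k; apply/prodf_neq0 => i _; rewrite iter_gal_eq0. Qed.

(** Each Galois automorphism is s^i for exactly one i < m. *)
Lemma partial_norm_dim s k : generator 'Gal({:L} / 1) s ->
  partial_norm s m k = galNorm 1 {:L} k.
Proof.
move=> gen_s; rewrite /galNorm (eqP gen_s).
have inj : {in [set: 'I_m] &, injective (fun i : 'I_m => (s ^+ i)%g)}.
  move=> i j _ _ /eqP; rewrite eq_expg_mod_order order_generator // !modn_small //.
  by move=> /eqP/val_inj.
have -> : <[s]>%g = [set (s ^+ i)%g | i : 'I_m in [set: 'I_m]].
  apply/eqP; rewrite eq_sym eqEcard; apply/andP; split.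
    by apply/subsetP=> _ /imsetP[i _ ->]; apply: mem_cycle.
  by rewrite card_in_imset // cardsT card_ord -(order_generator gen_s).
rewrite big_imset // /partial_norm; apply: eq_big => [i|i _]; rewrite ?inE //.
by rewrite gal_iter.
Qed.

End TwistedNorm.

(** * Isomorphisms between the algebras *)

Section Isomorphisms.
Variables (F : finFieldType) (L : splittingFieldType F).
Local Notation m := (\dim {:L}).
Implicit Types (s t rho : gal_of {:L}) (a b x y k : L).
Local Notation mono := monomial.

Lemma coord_mul_constant s a (v : petit L s a) x i :
  xcoord (nmul v (mono x 0 : petit L s a)) i = xcoord v i * iter i s x.
Proof.
have [lt_im|le_mi] := ltnP i m; last by rewrite !coord_ge ?mul0r.
rewrite {1}(mono_sum v) nmul_suml; under eq_bigr => j _ do rewrite mul_constant //.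
by rewrite (coord_mono_sum (fun j => xcoord v j * iter j s x)).
Qed.

(** The isomorphism applies rho to the coefficients and sends X to k X.  The
    hypothesis says that (k X)^m = N(k) b is the image of X^m = a. *)
Lemma scaling_iso s a b rho k : k != 0 -> rho a = partial_norm s m k * b ->
  nalg_iso (petit L s a) (petit L s b).
Proof.
move=> nz_k rho_a; pose N j := partial_norm s j k.
pose f (v : petit L s a) : petit L s b := of_coord (fun j => rho (xcoord v j) * N j).
have co_f v j : xcoord (f v) j = rho (xcoord v j) * N j.
  by rewrite coord_of; case: ltnP => // le_mj; rewrite coord_ge // rmorph0 mul0r.
have fD u v : f (u + v) = f u + f v.
  by apply: coordP => j _; rewrite coordD !co_f coordD rmorphD mulrDl.
have f_sum I (r : seq I) P G : f (\sum_(i <- r | P i) G i) = \sum_(i <- r | P i) f (G i).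
  apply: (big_morph f fD); apply: coordP => j _.
  by rewrite co_f !coord0 rmorph0 mul0r.
have f_mono x j : f (mono x j) = mono (rho x * N j) j.
  apply: coordP => i _; rewrite co_f !coord_mono.
  by case: ifP => [/andP[_ /eqP->]|]; rewrite ?rmorph0 ?mul0r.
exists f; split.
- move=> c u v; apply: coordP => j _.
  rewrite coordD coordZ !co_f coordD coordZ rmorphD mulrDl /=.
  by rewrite galZ -scalerAl.
- exists (fun w => of_coord (fun j => (rho^-1)%g (xcoord w j / N j))) => v;
  apply: coordP => j lt_jm; rewrite ?co_f coord_of lt_jm ?co_f.
    by rewrite mulfK ?partial_norm_neq0 // -galM ?memvf // mulgV gal_id.
  by rewrite -galM ?memvf // mulVg gal_id divfK // partial_norm_neq0.
move=> u v; rewrite [in LHS](mono_sum u) [in LHS](mono_sum v).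
rewrite [in RHS](mono_sum u) [in RHS](mono_sum v) !f_sum !nmul_suml f_sum.
apply: eq_bigr => i _; rewrite !nmul_sumr f_sum; apply: eq_bigr => j _.
rewrite mul_mono // !f_mono mul_mono //; congr mono.
set x := xcoord u i; set y := xcoord v j.
rewrite !rmorphM !iter_galM /=.
have comm_iter n z : rho (iter n s z) = iter n s (rho z).
  by rewrite !gal_iter gal_comm.
rewrite comm_iter /power_coef rmorphXn /= comm_iter rho_a.
have N_ij : N i * iter i s (N j) = N (i + j)%N by rewrite /N partial_normD.
have [lt_m|le_m] := ltnP (i + j)%N m.
  by rewrite modn_small // divn_small // !expr0 -N_ij; ring.
have lt_r : (i + j - m < m)%N by have := ltn_ord i; have := ltn_ord j; lia.
rewrite -(subnK le_m) divnDr ?dvdnn // divnn dim_gt0 divn_small // add0n.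
rewrite modnDr modn_small // !expr1 !iterD !iter_dim iter_galM.
have -> : rho x * N i * (iter i s (rho y) * iter i s (N j)) =
  rho x * iter i s (rho y) * (N i * iter i s (N j)) by ring.
rewrite N_ij -(subnK le_m) /N partial_normD addnK.
by ring.
Qed.

Section Rigidity.
Variables (s t : gal_of {:L}) (a b : L).
Hypotheses (m_gt1 : (1 < m)%N).
Hypotheses (gen_s : generator 'Gal({:L} / 1) s) (gen_t : generator 'Gal({:L} / 1) t).
Hypotheses (a_notin : a \notin 1%VS) (b_notin : b \notin 1%VS).
Local Notation A := (petit L s a).
Local Notation B := (petit L t b).
Variable f : A -> B.
Hypotheses (f_lin : linear f) (f_bij : bijective f).
Hypothesis fM : forall u v, f (nmul u v) = nmul (f u) (f v).

Lemma isoD : {morph f : u v / u + v}.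
Proof. by move=> u v; have := f_lin 1 u v; rewrite !scale1r. Qed.

Lemma iso0 : f 0 = 0.
Proof. by apply: (addrI (f 0)); rewrite -isoD !addr0. Qed.

Lemma isoZ (c : F) u : f (c *: u) = c *: f u.
Proof. by have := f_lin c u 0; rewrite iso0 !addr0. Qed.

Lemma iso_sum I (r : seq I) P (G : I -> A) :
  f (\sum_(i <- r | P i) G i) = \sum_(i <- r | P i) f (G i).
Proof. exact: (big_morph f isoD iso0). Qed.

Lemma iso_associator u v w : f (associator u v w) = associator (f u) (f v) (f w).
Proof.
rewrite /associator isoD !fM; congr (_ + _).
by rewrite -[- nmul _ _]scaleN1r isoZ scaleN1r !fM.
Qed.

Lemma iso_eq0 u : (f u == 0) = (u == 0).
Proof.
apply/eqP/eqP => [fu0|->]; last exact: iso0.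
by apply: (bij_inj f_bij); rewrite fu0 iso0.
Qed.

Lemma iso_surj w : exists v, w = f v.
Proof. by case: f_bij => g _ fK; exists (g w); rewrite fK. Qed.

Let sa : s a != a. Proof. by rewrite -fixed_generator. Qed.
Let tb : t b != b. Proof. by rewrite -fixed_generator. Qed.

Lemma iso_one : f (mono 1 0 : A) = mono 1 0.
Proof.
have [v one_fv] := iso_surj (mono 1 0).
by rewrite one_fv -[in RHS](proj1 (unit_one v)) fM -one_fv (proj2 (unit_one _)).
Qed.

(** Isomorphisms preserve the left nucleus, which consists of the constants on both
    sides; the induced map of K is a ring morphism fixing the base field, hence a
    Galois automorphism. *)
Lemma iso_constant : exists rho : gal_of {:L},
  forall x, f (mono x 0 : A) = mono (rho x) 0.
Proof.
pose r x := xcoord (f (mono x 0 : A)) 0%N.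
have fr x : f (mono x 0 : A) = mono (r x) 0.
  have nuc_fx : left_nucleus (f (mono x 0 : A)).
    move=> v w; have [v' ->] := iso_surj v; have [w' ->] := iso_surj w.
    by rewrite -iso_associator constant_left_nucleus iso0.
  have [y fx] := (left_nucleusP m_gt1 tb (f (mono x 0 : A))).1 nuc_fx.
  by rewrite /r fx coord_mono dim_gt0.
have r_zmod : zmod_morphism r.
  move=> x y; rewrite /r monoD isoD coordD -scaleN1r monoZ.
  by rewrite isoZ coordZ scaleN1r.
have r_monoid : monoid_morphism r.
  split; first by rewrite /r iso_one coord_mono dim_gt0.
  move=> x y; apply: (@mono_inj F L _ _ 0%N); first exact: dim_gt0.
  rewrite -(@constant_mul _ _ t b) ?dim_gt0 // -!fr -fM.
  by rewrite constant_mul // dim_gt0.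
have r_scale : scalable r by move=> c x; rewrite /r monoZ isoZ coordZ.
pose rA := GRing.isZmodMorphism.Build _ _ r r_zmod.
pose rM := GRing.isMonoidMorphism.Build _ _ r r_monoid.
pose rZ := GRing.isScalable.Build _ _ _ _ r r_scale.
pose rLRM : {lrmorphism _ -> _} := HB.pack r rA rM rZ.
have [r1 r_mul] := r_monoid.
have /kAut_to_gal[rho _ r_rho]: kAut 1 {:L} (linfun rLRM).
  rewrite kAutfE; apply/kHom_monoid_morphism; split=> [|x y].
    by rewrite lfunE.
  by rewrite !lfunE /= r_mul.
by exists rho => x; rewrite fr -r_rho ?memvf // lfunE.
Qed.

(** The image G of X satisfies G c = s(c) G for constants c, which leaves room for
    one monomial of degree i with t^i = s only.  The associator pattern then
    excludes i > 1. *)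
Lemma iso_rigid : s = t /\
  exists rho : gal_of {:L}, exists2 k, k != 0 & rho a = partial_norm s m k * b.
Proof.
have [rho f_const] := iso_constant.
pose G := f (mono 1 1).
have nz_G : G != 0 by rewrite iso_eq0 mono_eq0 ?oner_eq0.
(* The coordinate i of the image of X c = s(c) X. *)
have comm_G i x : xcoord G i != 0 -> iter i t x = s x.
  move=> nz_Gi; pose c := (rho^-1)%g x.
  have rho_c : rho c = x by rewrite -galM ?memvf // mulVg gal_id.
  have : nmul G (mono (rho c) 0 : B) = nmul (mono (rho (s c)) 0 : B) G.
    rewrite -!f_const -!fM mul_constant // constant_mul //.
    by rewrite mul1r mulr1.
  move/(congr1 (fun w : B => xcoord w i)).
  rewrite coord_mul_constant coord_constant_mul gal_comm rho_c mulrC.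
  exact: mulIf.
have [i lt_im nz_Gi] : exists2 i, (i < m)%N & xcoord G i != 0.
  case: (pickP (fun i : 'I_m => xcoord G i != 0)) => [i nz_Gi|G0].
    by exists i.
  case/eqP: nz_G; apply: coord_ordP => i; rewrite coord0.
  by apply/eqP/negbFE/G0.
have ti_s x : iter i t x = s x by apply: comm_G.
set k := xcoord G i in nz_Gi.
have def_G : G = mono k i.
  apply: coord_ordP => j; rewrite coord_mono ltn_ord /=; case: eqP => [->//|ne_ji].
  have [//|nz_Gj] := eqVneq (xcoord G j) 0; case: ne_ji.
  by apply: (generator_expg_inj gen_t) => // x; rewrite ti_s; apply: comm_G.
(* For j + 1 < m the product X^j X = X^(j + 1) needs no reduction in the source, so
   degrees are multiplied by i modulo m. *)
have f_pow j : (j < m)%N -> exists2 y, y != 0 & f (mono 1 j) = mono y ((j * i) %% m)%N.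
  elim: j => [|j IHj] lt_jm.
    by exists 1; rewrite ?oner_eq0 // mul0n mod0n iso_one.
  have [y nz_y f_j] := IHj (ltnW lt_jm).
  have -> : mono 1 j.+1 = nmul (mono 1 j : A) (mono 1 1).
    rewrite mul_mono ?(ltnW lt_jm) // addn1 modn_small // /power_coef divn_small //.
    by rewrite iter_gal1 !mulr1.
  rewrite fM f_j -/G def_G mul_mono ?ltn_mod ?dim_gt0 // modnDml -mulSnr.
  eexists; last by [].
  rewrite !mulf_neq0 ?iter_gal_eq0 // /power_coef expf_neq0 // iter_gal_eq0.
  by apply: contraNneq b_notin => ->; rewrite mem0v.
have f_mono x j : (j < m)%N -> exists y, f (mono x j) = mono y ((j * i) %% m)%N.
  move=> lt_jm; have [y _ f_j] := f_pow j lt_jm; exists (rho x * y).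
  rewrite -[x in LHS]mulr1 -(@constant_mul _ _ s a) // fM f_const f_j.
  by rewrite constant_mul // ltn_mod dim_gt0.
have i_gt0 : (0 < i)%N.
  rewrite lt0n; apply: contraNneq sa => i0; rewrite -ti_s i0 //.
(* Some X^j is sent to the top degree m - 1, by surjectivity. *)
have [j lt_jm ji] : exists2 j, (j < m)%N & ((j * i) %% m = m.-1)%N.
  have lt_m1 : (m.-1 < m)%N by rewrite prednK ?dim_gt0.
  have [v fv] := iso_surj (mono 1 m.-1).
  case: (pickP (fun j : 'I_m => ((j * i) %% m == m.-1)%N)) => [j /eqP|no_j].
    by exists j.
  have := congr1 (fun w : B => xcoord w m.-1) fv.
  rewrite (mono_sum v) iso_sum coord_sum coord_mono lt_m1 eqxx big1 => [/eqP|j _].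
    by rewrite oner_eq0.
  have [y ->] := f_mono (xcoord v j) j (ltn_ord j).
  by rewrite coord_mono eq_sym no_j andbF.
have i1 : i = 1%N.
  (* If j + 1 < m the triple (X^j, X, X) associates, but its image, of degrees
     (m - 1, i, i), wraps around at the first product. *)
  have [lt_j1m|le_mj1] := ltnP j.+1 m.
    have [y nz_y f_j] := f_pow j lt_jm.
    have assoc0 : associator (mono 1 j : A) (mono 1 1) (mono 1 1) = 0.
      by rewrite assoc_mono // assoc_coef_small ?addn1 // mulr0 mono0.
    have := iso_associator (mono 1 j) (mono 1 1) (mono 1 1).
    rewrite assoc0 iso0 f_j -/G def_G ji => /esym/eqP.
    have lt_m1 : (m.-1 < m)%N by rewrite prednK ?dim_gt0.
    rewrite assoc_mono // mono_eq0 ?ltn_mod ?dim_gt0 // mulf_eq0.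
    rewrite (negPf (assoc_coef_neq0 _ _ _ _)) //; [|by lia|by rewrite ti_s -fixed_generator].
    by rewrite !mulf_eq0 !iter_gal_eq0 (negPf nz_y) (negPf nz_Gi).
  (* If j = m - 1, then (m - 1) i = m - 1 modulo m, so i = 1 modulo m. *)
  have {le_mj1} j1 : j = m.-1 by lia.
  have /eqP : ((m.-1 + i) %% m = 0)%N.
    by rewrite -[in LHS]ji modnDml j1 -mulSnr prednK ?dim_gt0 // modnMr.
  rewrite -(prednK i_gt0) addnS -addSn prednK ?dim_gt0 // modnDl modn_small; last by lia.
  by move=> /eqP->.
have st : s = t.
  by apply/eqP/gal_eqP => x _; rewrite -ti_s i1.
split=> //; exists rho, k => //.
have f_norm n : (n < m)%N -> f (mono 1 n) = mono (partial_norm s n k) n.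
  elim: n => [|n IHn] lt_nm; first by rewrite /partial_norm big_ord0 iso_one.
  have -> : mono 1 n.+1 = nmul (mono 1 n : A) (mono 1 1).
    rewrite mul_mono ?(ltnW lt_nm) // addn1 modn_small // /power_coef divn_small //.
    by rewrite iter_gal1 !mulr1.
  rewrite fM IHn ?(ltnW lt_nm) // -/G def_G i1 mul_mono ?(ltnW lt_nm) // addn1.
  by rewrite modn_small // /power_coef divn_small // mulr1 partial_normS st.
(* Compare both sides of X^(m-1) X = a. *)
have lt_m1 : (m.-1 < m)%N by rewrite prednK ?dim_gt0.
have := fM (mono 1 m.-1) (mono 1 1).
rewrite f_norm // -/G def_G i1 !mul_mono // addn1 prednK ?dim_gt0 // modnn.
rewrite iter_gal1 !mul1r f_const /power_coef divnn dim_gt0 !iter_dim !expr1.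
move/(mono_inj (dim_gt0 L)) => ->; congr (_ * _).
by rewrite -[in RHS](prednK (dim_gt0 L)) partial_normS st.
Qed.
End Rigidity.
End Isomorphisms.

(** * Primitive elements and surjectivity of the norm *)

Section FiniteExtension.
Variables (F : finFieldType) (L : splittingFieldType F).
Local Notation m := (\dim {:L}).
Local Notation q := #|F|.
Local Notation E := (finvect_type L).
Implicit Types (s rho : gal_of {:L}) (x y k : L).

Lemma card_base_field_gt1 : (1 < q)%N.
Proof. exact: finNzRing_gt1. Qed.

(** The group of units of a finite field is cyclic. *)
Lemma finite_field_primitive : exists2 w : L,
    forall x, x != 0 -> exists n, x = w ^+ n
  & forall n, w ^+ n = 1 -> ((q ^ m).-1 %| n)%N.
Proof.
have /cyclicP[w gen_w] := field_unit_group_cyclic [set: {unit E}]%G.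
exists (val w : E) => [x nz_x|n wn1].
  have : finField_unit (nz_x : (x : E) != 0) \in <[w]>%g by rewrite -gen_w inE.
  by case/cycleP=> n /(congr1 val); rewrite FinRing.val_unitX; exists n.
have <-: #[w]%g = (q ^ m).-1.
  by rewrite /order -gen_w card_finField_unit card_extension.
by rewrite order_dvdn -val_eqE FinRing.val_unitX FinRing.val_unit1; apply/eqP.
Qed.

(** An automorphism fixing a generator of the group of units is the identity. *)
Lemma primitive_distinct s : generator 'Gal({:L} / 1) s ->
  exists a : L, forall i, (0 < i < m)%N -> iter i s a != a.
Proof.
move=> gen_s; have [w gen_w _] := finite_field_primitive; exists w => i /andP[i_gt0 lt_im].
apply: contraTneq i_gt0 => fix_w; rewrite -eqn0Ngt; apply/eqP.
apply: (generator_expg_inj gen_s) => //= [|x]; first exact: dim_gt0.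
have [->|/gen_w[n ->]] := eqVneq x 0; first by rewrite iter_gal0.
by rewrite iter_galX fix_w.
Qed.

Lemma frobenius_expr_base x : x \in 1%VS -> x ^+ q = x.
Proof.
move=> Fx; by have := Fermat's_little_theorem 1%AS x; rewrite Fx dimv1 expn1 => /esym/eqP.
Qed.

(** The norm raises to the power e = 1 + q + ... + q^(m-1), computed with the
    Frobenius generator.  If c = w^n with w of order (q - 1) e, then c^(q-1) = 1
    forces e to divide n, so that c is the norm of w^(n / e). *)
Lemma galNorm_surj c : c \in 1%VS -> c != 0 ->
  exists2 k : L, k != 0 & galNorm 1 {:L} k = c.
Proof.
move=> Fc nz_c; have [alpha gen_alpha alphaE] := finField_galois_generator (sub1v {:L}%AS).
have alpha_iter i x : iter i alpha x = x ^+ (q ^ i).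
  elim: i => //= i ->; rewrite alphaE ?memvf // dimv1 expn1 -exprM.
  by rewrite expnSr.
have normE x : galNorm 1 {:L} x = x ^+ (\sum_(i < m) q ^ i).
  rewrite -(partial_norm_dim _ gen_alpha) /partial_norm.
  under eq_bigr => i _ do rewrite alpha_iter.
  by rewrite prodrXr.
have [w gen_w ord_w] := finite_field_primitive.
have q_gt1 := card_base_field_gt1.
have [n def_c] := gen_w c nz_c.
have /ord_w : w ^+ (q.-1 * n) = 1.
  apply: (mulfI nz_c); rewrite mulr1 mulnC exprM -def_c -exprS prednK ?(ltnW q_gt1) //.
  exact: frobenius_expr_base.
rewrite predn_exp dvdn_pmul2l; last by case: q q_gt1 => [|[]].
case/dvdnP=> e def_n; have norm_c : galNorm 1 {:L} (w ^+ e) = c.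
  by rewrite normE def_c def_n exprM.
by exists (w ^+ e); rewrite // -(galNorm_eq0 1 {:L}) norm_c.
Qed.

Hypothesis m_prime : prime m.

(** * Extensions of prime degree and orbit counting *)

Lemma prime_generator s : s != 1%g -> generator 'Gal({:L} / 1) s.
Proof.
move=> s_neq1; rewrite /generator eq_sym eqEcard cycle_subG mem_gal_base card_gal_base.
have: (#[s]%g %| m)%N by rewrite -card_gal_base order_dvdG ?mem_gal_base.
case/primeP: m_prime => _ dvd_m /dvd_m; rewrite order_eq1 (negPf s_neq1) /=.
by move/eqP=> <-; rewrite leqnn.
Qed.

(** For 0 < i < m the automorphism s^i is a generator too, since m is prime, so it
    fixes the base field only. *)
Lemma prime_distinct s a i : generator 'Gal({:L} / 1) s -> a \notin 1%VS ->
  (0 < i < m)%N -> iter i s a != a.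
Proof.
move=> gen_s a_notin /andP[i_gt0 lt_im]; rewrite gal_iter -fixed_generator //.
apply: prime_generator; apply: contraTneq i_gt0 => si; rewrite -eqn0Ngt; apply/eqP.
apply: (generator_expg_inj gen_s) => // [|x]; first exact: dim_gt0.
by rewrite !gal_iter si.
Qed.

Lemma card_nonbase : #|[set x : E | x \notin (1%VS : {vspace L})]| = (q ^ m - q)%N.
Proof.
have -> : [set x : E | x \notin (1%VS : {vspace L})] = ~: [set x in (1%VS : {vspace E})].
  by apply/setP=> x; rewrite !inE.
rewrite cardsCs setCK card_extension cardsE.
by rewrite (card_vspace (1%VS : {vspace E})) dimv1 expn1.
Qed.

(** The action of scalars and automorphisms on K whose orbits classify the algebras
    of a given generator.  The carrier is K seen as a finite type, so that orbits
    can be counted. *)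
Definition twist (x : E) (g : {unit F} * gal_of {:L}) : E :=
  val g.1 *: (g.2 (x : L) : L).

Lemma twist1 : twist^~ 1%g =1 id.
Proof. by move=> x; rewrite /twist /= scale1r gal_id. Qed.

Lemma twistM x : act_morph twist x.
Proof.
move=> g h; rewrite /twist /= galZ -galM ?memvf // scalerA.
by rewrite mulrC.
Qed.

Canonical twist_action := TotalAction twist1 twistM.

Local Notation nonbase := [set x : E | x \notin (1%VS : {vspace L})].
Local Notation G := [set: {unit F} * gal_of {:L}].

(** Membership in the base field is invariance under a generator, and generators
    commute with scalars and automorphisms. *)
Lemma base_twist x g : (twist x g \in (1%VS : {vspace L})) = (x \in (1%VS : {vspace L})).
Proof.
have [alpha gen_alpha _] := finField_galois_generator (sub1v {:L}%AS).
rewrite !(fixed_generator _ gen_alpha) /twist galZ (gal_comm alpha).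
have nz_c : val g.1 != 0 :> F by rewrite -unitfE (valP g.1).
by rewrite (inj_eq (scalerI nz_c)) (inj_eq (@gal_inj _ _ _)).
Qed.

Lemma twist_acts : [acts G, on nonbase | twist_action].
Proof.
apply/subsetP=> g _; rewrite !inE /=; apply/subsetP=> x; rewrite !inE /=.
by rewrite base_twist.
Qed.

Lemma unit_val_neq0 (c : {unit F}) : val c != 0.
Proof. by rewrite -unitfE (valP c). Qed.

Lemma galNorm_scalar (c : F) : galNorm 1 {:L} (c%:A) = c%:A ^+ m.
Proof.
rewrite /galNorm (eq_bigr (fun _ => c%:A)) => [|rho _]; last by rewrite galZ rmorph1.
by rewrite prodr_const card_gal_base.
Qed.

(** If c rho(x) = x, iterating m times gives c^m x = x. *)
Lemma twist_fixed_expr (c : {unit F}) rho x :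
  x \notin (1%VS : {vspace L}) -> twist x (c, rho) = x -> (c ^+ m = 1)%g.
Proof.
move=> x_notin fix_x; apply: val_inj; rewrite FinRing.val_unitX FinRing.val_unit1.
have iter_x n : val c ^+ n *: iter n rho x = x.
  elim: n => [|n IHn]; first by rewrite expr0 scale1r.
  rewrite -[RHS]fix_x /twist /= -[in RHS]IHn galZ scalerA -exprS; congr (_ *: _).
have := iter_x m; rewrite iter_dim => /eqP; rewrite -subr_eq0 -[X in _ - X]scale1r.
rewrite -scalerBl scaler_eq0 subr_eq0 => /orP[/eqP//|/eqP x0].
by rewrite x0 mem0v in x_notin.
Qed.

Definition twist_torsion := [set c : {unit F} | (c != 1%g) && (c ^+ m == 1)%g].

(** Let rho <> 1, so that rho is a generator.  Then c = 1 fixes only the base field,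
    and c^m <> 1 fixes nothing nonzero.  If c^m = 1 and c <> 1, then c has norm 1,
    so c = x0 / rho(x0) by Hilbert 90; the fixed elements are the multiples of
    x0, because the quotient of two of them is fixed by rho. *)
Lemma card_fixed_twist (c : {unit F}) rho :
  #|'Fix_(nonbase | twist_action)[(c, rho)]%g| =
  if rho == 1%g then (if c == 1%g then (q ^ m - q)%N else 0%N)
  else if c \in twist_torsion then q.-1 else 0%N.
Proof.
set Fix := 'Fix_(_ | _)[_]%g.
have FixP (x : E) : (x \in Fix) =
    (x \notin (1%VS : {vspace L})) && (twist x (c, rho) == x).
  by rewrite /Fix !inE sub1set !inE.
have no_fix : (forall x : E, x \notin (1%VS : {vspace L}) -> twist x (c, rho) <> x) ->
    #|Fix| = 0%N.
  move=> no_fix; apply: eq_card0 => x; rewrite FixP.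
  by apply/negbTE/negP => /andP[/no_fix ne_x /eqP].
case: eqVneq => [rho1|rho_neq1].
  case: eqVneq => [c1|c_neq1].
    rewrite -card_nonbase; apply: eq_card => x.
    by rewrite FixP c1 rho1 inE twist1 eqxx andbT.
  apply: no_fix => x x_notin; rewrite /twist rho1 /= gal_id => /eqP.
  rewrite -subr_eq0 -[X in _ - X]scale1r -scalerBl scaler_eq0 subr_eq0.
  case/orP=> /eqP; last by move=> x0; rewrite x0 mem0v in x_notin.
  by move=> vc1; case/eqP: c_neq1; apply: val_inj.
have gen_rho := prime_generator rho_neq1.
rewrite inE; case: eqVneq => [c1|c_neq1] /=.
  apply: no_fix => x x_notin; rewrite /twist c1 scale1r /= => fix_x.
  by rewrite (@fixed_generator F L rho x gen_rho) fix_x eqxx in x_notin.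
case: eqVneq => [cm1|cm_neq1]; last first.
  apply: no_fix => x x_notin /(twist_fixed_expr x_notin) cm1.
  by rewrite cm1 eqxx in cm_neq1.
have norm_c : galNorm 1 {:L} ((val c)%:A) = 1.
  rewrite galNorm_scalar exprZn expr1n -FinRing.val_unitX cm1.
  by rewrite scale1r.
have /eqP/(Hilbert's_theorem_90 gen_rho (memvf _))[x0 [_ nz_x0] def_c] := norm_c.
have fix_x0 : twist x0 (c, rho) = x0.
  rewrite /twist /= -[LHS]mulr_algl def_c divfK // fmorph_eq0 //.
have x0_notin : x0 \notin 1%VS.
  apply: contra c_neq1 => x0_in; apply/eqP/val_inj/eqP.
  move: x0_in; rewrite (fixed_generator _ gen_rho) => /eqP fix0.
  move: fix_x0; rewrite /twist /= fix0 => /eqP.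
  rewrite -subr_eq0 -[X in _ - X]scale1r -scalerBl scaler_eq0 subr_eq0.
  by rewrite (negPf nz_x0) orbF.
rewrite -card_finField_unit -(card_imset _ (f := fun d : {unit F} => val d *: x0 : E)).
  apply: eq_card => x; rewrite FixP; apply/andP/imsetP => [[x_notin /eqP fix_x]|[d _ ->]].
    have fix_q : rho ((x : L) / x0) = x / x0.
      rewrite -[in RHS]fix_x -[in RHS]fix_x0 /twist /= fmorph_div.
      rewrite -[_ *: rho x]mulr_algl -[_ *: rho x0]mulr_algl -mulf_div mulfV ?mul1r //.
      by rewrite scaler_eq0 oner_eq0 orbF unit_val_neq0.
    have /vlineP[e def_e] : (x : L) / x0 \in 1%VS.
      by rewrite (fixed_generator _ gen_rho) fix_q.
    have def_x : x = e *: x0 by rewrite -[e *: x0]mulr_algl -def_e divfK.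
    have nz_e : e != 0.
      by apply: contraNneq x_notin => e0; rewrite def_x e0 scale0r mem0v.
    by exists (finField_unit nz_e).
  have := base_twist x0 (d, 1%g); rewrite {1}/twist /= gal_id => ->.
  split=> //; apply/eqP; rewrite -[in RHS]fix_x0 /twist /= galZ !scalerA.
  by rewrite mulrC.
move=> d e /eqP; rewrite -subr_eq0 -scalerBl scaler_eq0 (negPf nz_x0) orbF subr_eq0.
by move/eqP/val_inj.
Qed.

(** The group of scalars is cyclic of order q - 1, so it has a subgroup of prime order
    m exactly when m divides q - 1, and then only one. *)
Lemma card_twist_torsion : #|twist_torsion| = if (m %| q.-1)%N then m.-1 else 0%N.
Proof.
have ord_torsion c : c \in twist_torsion -> #[c]%g = m.
  rewrite inE => /andP[c_neq1 /eqP cm1].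
  have : (#[c]%g %| m)%N by rewrite order_dvdn cm1.
  by case/primeP: m_prime => _ dvd_m /dvd_m; rewrite order_eq1 (negPf c_neq1) => /eqP.
case: ifP => [m_dvd|m_ndvd]; last first.
  apply: eq_card0 => c; apply: contraFF m_ndvd => /ord_torsion <-.
  by rewrite -card_finField_unit order_dvdG ?inE.
have [|z _ ord_z] := @Cauchy _ m [set: {unit F}]%G m_prime.
  by rewrite card_finField_unit.
have -> : twist_torsion = <[z]>^#%g.
  apply/setP=> c; rewrite !inE; apply: andb_id2l => c_neq1.
  apply/eqP/idP => [cm1|c_in]; last first.
    by apply/eqP; rewrite -order_dvdn -ord_z order_dvdG.
  have /ord_torsion ord_c : c \in twist_torsion by rewrite inE c_neq1 cm1 eqxx.
  have := eq_subG_cyclic (field_unit_group_cyclic [set: {unit F}]%G)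
    (subsetT <[c]>%G) (subsetT <[z]>%G).
  by rewrite -!orderE ord_c ord_z eqxx => /eqP <-; apply: cycle_id.
have := cardsD1 1%g <[z]>%g; rewrite -orderE ord_z group1 => ->.
by [].
Qed.

(** Burnside's lemma; the sum over rho splits into rho = 1 and the m - 1 others. *)
Lemma card_twist_orbits :
  (#|orbit twist_action G @: nonbase| * (m * q.-1)
   = q ^ m - q + m.-1 * #|twist_torsion| * q.-1)%N.
Proof.
have card_gal : #|{: gal_of {:L}}| = m.
  by rewrite -card_gal_base; apply: eq_card => rho; rewrite mem_gal_base.
have card_G : #|G| = (m * q.-1)%N.
  by rewrite cardsT card_prod card_gal -cardsT card_finField_unit mulnC.
rewrite -card_G -(Frobenius_Cauchy twist_acts).
rewrite (eq_bigl predT) => [|g]; last by rewrite inE.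
rewrite (eq_bigr (fun g => #|'Fix_(nonbase | twist_action)[(g.1, g.2)]%g|)) => [|[]//].
rewrite -(pair_bigA _ (fun c rho => #|'Fix_(nonbase | twist_action)[(c, rho)]%g|)) /=.
under eq_bigr => c _.
  rewrite (bigD1 1%g) //= card_fixed_twist eqxx.
  rewrite (eq_bigr (fun=> if c \in twist_torsion then q.-1 else 0%N)); last first.
    by move=> rho rho_neq1; rewrite card_fixed_twist (negPf rho_neq1).
  rewrite sum_nat_const (_ : #|_| = m.-1); last by rewrite cardC1 card_gal.
  over.
rewrite big_split /=; congr (_ + _)%N.
  by rewrite -big_mkcond big_pred1_eq.
by rewrite -big_distrr /= -big_mkcond sum_nat_const mulnA.
Qed.
End FiniteExtension.

(** * Opposite algebras *)

Section Opposite.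
Variables (F : fieldType).
Implicit Types A B : nalg F.

Lemma opp_iso A B : nalg_iso (opp_nalg A) (opp_nalg B) <-> nalg_iso A B.
Proof. by split=> -[f [f_lin f_bij fM]]; exists f; split=> // x y; apply: fM. Qed.

(** Reversing products exchanges the outer arguments, so that left and right nuclei
    are exchanged. *)
Lemma opp_associator A (x y z : A) :
  associator (x : opp_nalg A) y z = - associator z y x.
Proof. by rewrite /associator opprB. Qed.

Lemma opp_left_nucleus A (x : A) :
  @left_nucleus F (opp_nalg A) x <-> right_nucleus x.
Proof.
split=> nuc y z; last by rewrite opp_associator nuc oppr0.
by apply: oppr_inj; rewrite oppr0 -[RHS](nuc z y) opp_associator.
Qed.

Lemma opp_middle_nucleus A (x : A) :
  @middle_nucleus F (opp_nalg A) x <-> middle_nucleus x.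
Proof.
split=> nuc y z; last by rewrite opp_associator nuc oppr0.
by apply: oppr_inj; rewrite oppr0 -[RHS](nuc z y) opp_associator.
Qed.

Lemma opp_right_nucleus A (x : A) :
  @right_nucleus F (opp_nalg A) x <-> left_nucleus x.
Proof.
split=> nuc y z; last by rewrite opp_associator nuc oppr0.
by apply: oppr_inj; rewrite oppr0 -[RHS](nuc z y) opp_associator.
Qed.

Lemma opp_center A (x : A) : @Defs.center F (opp_nalg A) x <-> Defs.center x.
Proof.
split=> -[nuc_l nuc_m nuc_r comm]; split; try by apply/opp_middle_nucleus.
- exact/opp_right_nucleus.
- exact/opp_left_nucleus.
- by move=> y; apply: esym (comm y).
- exact/opp_left_nucleus.
- exact/opp_right_nucleus.
- by move=> y; apply: esym (comm y).
Qed.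
End Opposite.

Lemma opp_semifield (F : finFieldType) (A : nalg F) :
  semifield A -> semifield (opp_nalg A).
Proof.
case=> [[e unit_e] [nz_A div_A]]; split; first by exists e => x; case: (unit_e x).
by split=> // x /div_A[].
Qed.

(** If c is a complete invariant of isomorphism on a finite family of parameters, the
    classes correspond to the values of c on it. *)
(** * Classification and conclusion *)

Lemma num_iso_classes_param (F : fieldType) (P : nalg F -> Prop) (T U : finType)
    (D : {set T}) (al : T -> nalg F) (c : T -> U) :
    (forall A, P A <-> exists2 x, x \in D & A = al x) ->
    {in D &, forall x y, nalg_iso (al x) (al y) <-> c x = c y} ->
  num_iso_classes P #|c @: D|.
Proof.
move=> P_al iso_c.
have ex_x (i : 'I_#|c @: D|) : exists x, (x \in D) && (c x == enum_val i).
  by have /imsetP[x Dx ->] := enum_valP i; exists x; rewrite Dx eqxx.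
pose x i := xchoose (ex_x i).
have xP i : x i \in D /\ c (x i) = enum_val i.
  by have /andP[? /eqP] := xchooseP (ex_x i).
exists (fun i => al (x i)); split=> [i|i j|A /P_al[y Dy ->]].
- by apply/P_al; exists (x i) => //; case: (xP i).
- have [[Di ci] [Dj cj]] := (xP i, xP j).
  by move/(iso_c _ _ Di Dj); rewrite ci cj; apply: enum_val_inj.
have cy : c y \in c @: D by apply: imset_f.
exists (enum_rank_in cy (c y)).
have [Di ci] := xP (enum_rank_in cy (c y)).
by apply/(iso_c _ _ Dy Di); rewrite ci enum_rankK_in.
Qed.

Section Sandler.
Variables (F : finFieldType) (L : splittingFieldType F).
Local Notation m := (\dim {:L}).
Local Notation q := #|F|.
Local Notation E := (finvect_type L).
Local Notation nonbase := [set x : E | x \notin (1%VS : {vspace L})].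
Local Notation G := [set: {unit F} * gal_of {:L}].
Local Notation generators := [set s | generator 'Gal({:L} / 1)%g s].
Implicit Types (s t : gal_of {:L}) (a b x k : L).

Lemma card_generators : #|generators| = totient m.
Proof.
have /cyclicP[s gen_s] := cyclic_gal_base L.
by rewrite gen_s -totient_gen -(card_gal_base L) gen_s.
Qed.

(** Combines rigidity with surjectivity of the norm: the scalars N(k) that occur are
    all the nonzero elements of the base field. *)
Lemma petit_isoP s t a b : (1 < m)%N ->
    generator 'Gal({:L} / 1) s -> generator 'Gal({:L} / 1) t ->
    a \notin 1%VS -> b \notin 1%VS ->
  nalg_iso (petit L s a) (petit L t b) <->
  s = t /\ exists g : {unit F} * gal_of {:L}, b = twist a g.
Proof.
move=> m_gt1 gen_s gen_t a_notin b_notin.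
split=> [[f [f_lin f_bij fM]]|[-> [[c rho] ->]]].
  have [st [rho [k nz_k rho_a]]] :=
    iso_rigid m_gt1 gen_s gen_t a_notin b_notin f_lin f_bij fM.
  split=> //; move: rho_a; rewrite partial_norm_dim // => rho_a.
  have /vlineP[e norm_k] : galNorm 1 {:L} k \in 1%VS.
    by rewrite mem_galNorm ?memvf // galois_over_base.
  have nz_e : e != 0.
    apply: contraNneq nz_k => e0; rewrite -(galNorm_eq0 1 {:L}) norm_k e0.
    by rewrite scale0r.
  exists ((finField_unit nz_e)^-1, rho)%g; rewrite /twist /= rho_a norm_k mulr_algl.
  by rewrite scalerA mulVf ?scale1r.
have nz_c := unit_val_neq0 c.
have [||k nz_k norm_k] := @galNorm_surj F L ((val c)^-1)%:A.
- by rewrite rpredZ ?mem1v.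
- by rewrite scaler_eq0 invr_eq0 oner_eq0 orbF.
apply: (scaling_iso (rho := rho) nz_k); rewrite partial_norm_dim // norm_k.
by rewrite mulr_algl /twist scalerA mulVf ?scale1r.
Qed.

Hypothesis m_prime : prime m.

(** For m prime and a outside the base field the conditions on order, center and nuclei
    hold automatically, so the counted algebras are parametrized by all pairs. *)
Lemma counted_sandlerP A :
  counted_sandler L q m A <->
  exists2 p : gal_of {:L} * E, p \in setX generators nonbase
    & A = opp_nalg (petit L p.1 p.2).
Proof.
split=> [[[s [a [gen_s a_notin -> _]]] _ _ _]|[[s a]]].
  by exists (s, a); rewrite // !inE gen_s.
rewrite !inE /= => /andP[gen_s a_notin] ->; have m_gt1 := prime_gt1 m_prime.
have distinct i : (0 < i < m)%N -> iter i s a != a by apply: prime_distinct.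
have sa := distinct 1%N m_gt1.
split.
- exists s, a; split=> //; apply/opp_semifield/petit_semifield => //.
- pose V : finType := {poly_m (finvect_type L)}.
  have cardV : (q ^ (m ^ 2) = #|V|)%N by rewrite card_petit_space.
  exists (fun i => enum_val (cast_ord cardV i) : V).
  exists (fun v : V => cast_ord (esym cardV) (enum_rank v)) => [i|v].
    by rewrite enum_valK cast_ordK.
  by rewrite cast_ordKV enum_rankK.
- exists (monomial 1 0 : petit L s a) => [v|v].
    by case: (@unit_one F L s a v).
  by rewrite opp_center; apply: centerP.
have copy (S : opp_nalg (petit L s a) -> Prop) :
    (forall v, S v <-> exists x, v = monomial x 0) -> is_copy_of L S.
  move=> SP; exists (fun x => monomial x 0 : opp_nalg (petit L s a)); split=> //.
  - by move=> c x y; rewrite monoD monoZ.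
  - by move=> x y /mono_inj -> //; apply: dim_gt0.
  - by move=> x y; rewrite mulrC -(@constant_mul _ _ s a) ?dim_gt0.
split; apply: copy => v.
- by rewrite opp_left_nucleus; apply: right_nucleusP.
- by rewrite opp_middle_nucleus; apply: middle_nucleusP.
- by rewrite opp_right_nucleus; apply: left_nucleusP.
Qed.

(** The pair formed by the generator and the orbit of a is a complete invariant. *)
Lemma num_sandler :
  num_iso_classes (counted_sandler L q m)
    (m.-1 * #|orbit (twist_action L) G @: nonbase|).
Proof.
have <- : #|(fun p : gal_of {:L} * E => (p.1, orbit (twist_action L) G p.2))
    @: setX generators nonbase| = (m.-1 * #|orbit (twist_action L) G @: nonbase|)%N.
  rewrite -totient_prime // -card_generators -cardsX; congr #|pred_of_set _|.
  apply/setP=> -[s O]; rewrite in_setX; apply/imsetP/andP => /=.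
    by case=> -[t x] /setXP[gen_t x_in] [-> ->]; split=> //; apply: imset_f.
  case=> gen_s /imsetP[x x_in ->]; exists (s, x) => //.
  by rewrite in_setX gen_s.
apply: (num_iso_classes_param counted_sandlerP) => -[s a] [t b] /=.
rewrite !inE /= => /andP[gen_s a_notin] /andP[gen_t b_notin].
rewrite opp_iso petit_isoP ?prime_gt1 //.
split=> [[-> [g def_b]]|[-> /orbit_eqP]].
  congr (_, _); apply/orbit_eqP; rewrite orbit_sym; apply/orbitP.
  by exists g; rewrite ?inE.
by rewrite orbit_sym => /orbitP[g _ <-]; split=> //; exists g.
Qed.

End Sandler.

Theorem theorem4p5 (F : finFieldType) (L : splittingFieldType F) (q m : nat)
    (card_F : #|F| = q) (dim_L : \dim {:L} = m) (m_gt1 : (1 < m)%N) :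
  [/\ (* (i) *)
      [/\ cyclic 'Gal({:L} / 1), #|'Gal({:L} / 1)%g| = m,
          #|[set sigma | generator 'Gal({:L} / 1) sigma]| = totient m,
          forall sigma : gal_of {:L}, generator 'Gal({:L} / 1) sigma ->
            exists2 a : L, a \notin 1%VS & semifield (petit L sigma a)
        & forall (sigma tau : gal_of {:L}) (a b : L),
            generator 'Gal({:L} / 1) sigma -> generator 'Gal({:L} / 1) tau ->
            a \notin 1%VS -> b \notin 1%VS ->
            semifield (petit L sigma a) -> semifield (petit L tau b) ->
            sigma != tau -> ~ nalg_iso (petit L sigma a) (petit L tau b)],
      (* (ii) *)
      prime m -> ~~ (m %| q - 1)%N ->
      exists2 N : nat,
        N%:R = (m%:R - 1) * (q%:R ^+ m - q%:R) / (m%:R * (q%:R - 1)) :> rat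
        & num_iso_classes (@counted_sandler F L q m) N
    & (* (iii) *)
      prime m -> (m %| q - 1)%N ->
      exists2 N : nat,
        N%:R = (m%:R - 1) * ((m%:R - 1)
          + (q%:R ^+ m - q%:R - (q%:R - 1) * (m%:R - 1))
            / (m%:R * (q%:R - 1))) :> rat
        & num_iso_classes (@counted_sandler F L q m) N].
Proof.
subst q m; have q_gt1 := card_base_field_gt1 F.
set m := \dim {:L} in m_gt1 *; set q := #|F| in q_gt1 *.
have nz_m : m%:R != 0 :> rat by rewrite Num.Theory.pnatr_eq0 -lt0n ltnW.
have q1E : q.-1%:R = q%:R - 1 :> rat by rewrite -subn1 natrB // ltnW.
have m1E : m.-1%:R = m%:R - 1 :> rat by rewrite -subn1 natrB // ltnW.
have nz_q1 : q%:R - 1 != 0 :> rat.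
  by rewrite -q1E Num.Theory.pnatr_eq0 -lt0n -subn1 subn_gt0.
have le_qqm : (q <= q ^ m)%N by rewrite -[X in (X <= _)%N]expn1 leq_exp2l // ltnW.
have orbitsE : prime m ->
    #|orbit (twist_action L) [set: {unit F} * gal_of {:L}]
        @: [set x : finvect_type L | x \notin (1%VS : {vspace L})]|%:R
      * (m%:R * (q%:R - 1))
    = q%:R ^+ m - q%:R + (m%:R - 1) * #|twist_torsion L|%:R * (q%:R - 1) :> rat.
  move=> m_prime; have /(congr1 (fun n => n%:R : rat)) := card_twist_orbits m_prime.
  by rewrite natrM natrD !natrM natrB // natrX q1E m1E.
split.
- split; first exact: cyclic_gal_base.
  + exact: card_gal_base.
  + exact: card_generators.
  + move=> sigma gen_sigma; have [a distinct_a] := primitive_distinct gen_sigma.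
    exists a; last exact: petit_semifield.
    by rewrite (fixed_generator _ gen_sigma); apply: (distinct_a 1%N).
  + move=> sigma tau a b gen_s gen_t a_notin b_notin _ _ ne_st.
    case/(petit_isoP m_gt1 gen_s gen_t a_notin b_notin) => st _.
    by rewrite st eqxx in ne_st.
- move=> m_prime m_ndvd; eexists; last exact: num_sandler.
  have := orbitsE m_prime; rewrite (card_twist_torsion m_prime) -subn1 (negPf m_ndvd).
  rewrite mulr0 mul0r addr0 natrM m1E => <-.
  by field; rewrite nz_m nz_q1.
- move=> m_prime m_dvd; eexists; last exact: num_sandler.
  have := orbitsE m_prime; rewrite (card_twist_torsion m_prime) -subn1 m_dvd m1E natrM m1E.
  by move/(canLR (addrK _)) <-; field; rewrite nz_m nz_q1.
Qed.
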